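(* There is a universal constant $C$ such that the following holds. Let $X$ be an $n\times n$ real symmetric random matrix whose entries $(X_{ij})_{i\ge j}$ are independent, centered, and uniformly bounded. Then for every $p\in\mathbb{N}$ $$(\mathbf{E}\|X\|_{S_{2p}}^{2p})^{1/2p} \le 2\Bigg(\sum_i\Bigg(\sum_j \mathbf{E}[X_{ij}^2]\Bigg)^p\Bigg)^{1/2p} +C\sqrt{p}\,\Bigg(\sum_{i,j}\|X_{ij}\|_\infty^{2p}\Bigg)^{1/2p}.$$
   Context: $\|X\|_{S_{2p}}:=\mathrm{Tr}[|X|^{2p}]^{1/2p}$ is the Schatten $2p$-norm. $\|X_{ij}\|_\infty$ denotes the $L^\infty$ norm (essential supremum of $|X_{ij}|$) of the random variable $X_{ij}$. $\mathbb N=\{1,2,\dots\}$. ''Universal'' means independent of $n$, $p$ and the distribution of $X$. *)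

(* Defs.v *)
From HB Require Import structures.
From mathcomp Require Import all_boot all_order all_algebra.
From mathcomp Require Import complex.
From mathcomp Require Import all_classical all_reals all_analysis.

Set Implicit Arguments.
Unset Strict Implicit.
Unset Printing Implicit Defensive.

Import Order.TTheory GRing.Theory Num.Theory.
Import numFieldNormedType.Exports.

Local Open Scope classical_set_scope.
Local Open Scope ring_scope.

Definition psdmx (R : realType) (n : nat) (A : 'M[R]_n) : Prop :=
  A^T = A /\ forall v : 'rV[R]_n, 0 <= (v *m A *m v^T) 0 0.

(* |X| is the positive semidefinite square root of X^T X; the default value 0 *)
(* is never used, see mxabsP and psdmx_sqrt_uniq.                             *)
Definition mxabs (R : realType) (n : nat) (X : 'M[R]_n) : 'M[R]_n :=
  xget 0 [set A | psdmx A /\ A *m A = X^T *m X].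

Definition schatten_norm (R : realType) (n q : nat) (X : 'M[R]_n) : R :=
  (\tr (mxabs X ^+ q)) `^ (q%:R^-1).

(* Mutual independence of the subfamily of (X i) indexed by D. *)
Definition independent_RVs d (T : measurableType d) (R : realType)
    (P : probability T R) (I : finType) (D : {set I}) (X : I -> {RV P >-> R}) :
    Prop :=
  forall (J : {set I}) (B : I -> set R),
    J \subset D -> (forall i, i \in J -> measurable (B i)) ->
    P (\bigcap_(i in [set` J]) (X i @^-1` B i)) =
    (\prod_(i in J) P (X i @^-1` B i))%E.

Definition random_matrix d (T : measurableType d) (R : realType)
    (P : probability T R) (n : nat) (X : 'I_n -> 'I_n -> {RV P >-> R}) (w : T) :
    'M[R]_n :=
  \matrix_(i, j) X i j w.

Definition lower_triangle (n : nat) : {set 'I_n * 'I_n} :=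
  [set ij : 'I_n * 'I_n | (ij.2 <= ij.1)%N].

Section mxabs_wf.
Context {R : realType}.

Lemma poly_interpolation (F : fieldType) (f : F -> F) (s : seq F) :
  exists q : {poly F}, forall x, x \in s -> q.[x] = f x.
Proof.
elim: s => [|y s [q Hq]]; first by exists 0.
have [ys|ys] := boolP (y \in s).
  by exists q => x; rewrite inE => /orP[/eqP->|]; exact: Hq.
pose r := \prod_(z <- s) ('X - z%:P).
have ry : r.[y] != 0 by rewrite -[_ == 0]/(root r y) root_prod_XsubC.
exists (q + ((f y - q.[y]) / r.[y]) *: r) => x.
rewrite inE hornerD hornerZ => /orP[/eqP->|xs].
  by rewrite divfK// addrC subrK.
have /eqP-> : root r x by rewrite root_prod_XsubC.
by rewrite mulr0 addr0 Hq.
Qed.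

Lemma dotrow_ge0 n (u : 'rV[R]_n) : 0 <= (u *m u^T) 0 0.
Proof. by rewrite mxE sumr_ge0// => i _; rewrite mxE -expr2 sqr_ge0. Qed.

Lemma dotrow_eq0 n (u : 'rV[R]_n) : (u *m u^T) 0 0 = 0 -> u = 0.
Proof.
rewrite mxE => /eqP; rewrite psumr_eq0; last first.
  by move=> i _; rewrite mxE -expr2 sqr_ge0.
move=> /allP H; apply/rowP => i; rewrite mxE.
by have := H i (mem_index_enum _); rewrite mxE -expr2 sqrf_eq0 => /eqP.
Qed.

Lemma trmx_horner n (M : 'M[R]_n.+1) (q : {poly R}) :
  M^T = M -> (horner_mx M q)^T = horner_mx M q.
Proof.
move=> MT; elim/poly_ind: q => [|q a IH]; first by rewrite rmorph0 trmx0.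
rewrite rmorphD rmorphM /= horner_mx_X horner_mx_C linearD /= tr_scalar_mx.
rewrite -mulmxE trmx_mul IH MT; congr (_ + _).
exact: comm_mx_horner.
Qed.

Lemma psdmx_sqrt_horner n (X : 'M[R]_n.+1) :
  exists q : {poly R}, let A := horner_mx (X^T *m X) q in
    psdmx A /\ A *m A = X^T *m X.
Proof.
set M := X^T *m X.
have MT : M^T = M by rewrite /M trmx_mul trmxK.
pose c : {rmorphism R -> R[i]} := real_complex R.
pose MC := map_mx c M; pose XC := map_mx c X.
have cJ (x : R) : Num.conj (c x) = c x.
  by apply/CrealP; apply/complex_realP; exists x.
have cJm m1 m2 (Y : 'M[R]_(m1, m2)) :
    map_mx Num.conj (map_mx c Y) = map_mx c Y.
  by apply/matrixP => i j; rewrite !mxE cJ.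
have MCn : MC \is normalmx.
  by apply/normalmxP; rewrite (_ : map_mx _ MC^T = MC)// /MC map_trmx cJm MT.
have /orthomx_spectralP MCE := MCn.
set U := spectralmx MC in MCE; set d := spectral_diag MC in MCE.
have Uu : U \is unitarymx := spectral_unitarymx MC.
have Uinv : U \in unitmx := spectral_unit MC.
pose Y := U *m XC^T.
have dE : diag_mx d = Y *m map_mx Num.conj Y^T.
  rewrite trmx_mul trmxK map_mxM cJm -invmx_unitary// -mulmxA (mulmxA _ XC).
  rewrite [XC^T *m XC](_ : _ = MC); last by rewrite /MC map_mxM map_trmx.
  by rewrite MCE -[invmx U *m _ *m _]mulmxA !mulmxA mulmxK// mulmxV// mul1mx.
have d_ge0 i : 0 <= d 0 i.
  have /matrixP/(_ i i) := dE; rewrite !mxE eqxx mulr1n => ->.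
  by rewrite sumr_ge0// => k _; rewrite !mxE mul_conjC_ge0.
have dR i : d 0 i = c (complex.Re (d 0 i)).
  by have /ger0_real/complex_realP[x ->] := d_ge0 i.
have dR_ge0 i : 0 <= complex.Re (d 0 i).
  by have := d_ge0 i; rewrite dR /= ler0c.
have [q qE] := poly_interpolation (fun x => Num.sqrt (Num.sqrt x))
  [seq complex.Re (d 0 i) | i : 'I_n.+1].
have key : horner_mx M (q ^+ 4) = M.
  apply: (@map_mx_inj _ _ c); rewrite map_horner_mx -/MC [in RHS]MCE.
  rewrite MCE horner_mx_uconjC// horner_mx_diag; congr (_ *m diag_mx _ *m _).
  apply/rowP => i; rewrite mxE dR horner_map /=; congr (c _).
  rewrite horner_exp qE; last by apply/mapP; exists i; rewrite ?mem_enum.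
  by rewrite (exprM _ 2 2) !sqr_sqrtr// sqrtr_ge0.
exists (q ^+ 2); split; last first.
  by rewrite mulmxE -rmorphM -exprD.
split; first exact: trmx_horner.
move=> v; rewrite rmorphXn /= expr2 -mulmxE mulmxA -mulmxA.
by rewrite -{2}(trmx_horner q MT) -trmx_mul dotrow_ge0.
Qed.

Lemma mxabsP n (X : 'M[R]_n) :
  psdmx (mxabs X) /\ mxabs X *m mxabs X = X^T *m X.
Proof.
rewrite /mxabs; case: xgetP => [A _ []//|] /(_ _) noA; exfalso.
case: n X noA => [|n] X noA.
  apply: (noA 0); split; last by apply/matrixP => - [].
  by split=> [|v]; [apply/matrixP => - []|rewrite mxE big_ord0].
by have [q] := psdmx_sqrt_horner X; exact: noA.
Qed.

Lemma symmx_sqr0 n (S : 'M[R]_n) : S^T = S -> S *m S = 0 -> S = 0.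
Proof.
move=> ST SS; apply/row_matrixP => i; rewrite row0; apply: dotrow_eq0.
by rewrite rowE trmx_mul ST mulmxA -(mulmxA _ S S) SS mulmx0 mul0mx mxE.
Qed.

Lemma symmx_quad0 n (S : 'M[R]_n) :
  S^T = S -> (forall v : 'rV_n, (v *m S *m v^T) 0 0 = 0) -> S = 0.
Proof.
move=> ST S0; apply/row_matrixP => i; rewrite row0 rowE.
set v := delta_mx 0 i; apply: dotrow_eq0.
have addE (a b : 'M[R]_1) : (a + b) 0 0 = a 0 0 + b 0 0 by rewrite mxE.
have := S0 (v + v *m S); rewrite linearD /= !(mulmxDl, mulmxDr) !addE !S0.
rewrite add0r addr0 trmx_mul ST !mulmxA => /eqP.
by rewrite -mulr2n mulrn_eq0 => /eqP.
Qed.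

Lemma psdmx_sqrt_uniq n (A B : 'M[R]_n) :
  psdmx A -> psdmx B -> A *m A = B *m B -> A = B.
Proof.
case: n A B => [|n] A B; first by move=> _ _ _; apply/matrixP => - [].
have suf (E : 'M[R]_n.+1) : psdmx E -> forall q,
    let F := horner_mx (E^T *m E) q in
    psdmx F -> F *m F = E^T *m E -> E = F.
  move=> [ET E0] q F [FT F0]; rewrite ET => FF.
  have EF : E *m F = F *m E.
    by apply: comm_mx_horner; rewrite ET /comm_mx mulmxA.
  pose D := E - F.
  have DT : D^T = D by rewrite linearB /= ET FT.
  have DEF : D *m (E + F) = 0.
    by rewrite mulmxDr !mulmxBl FF EF addrA subrK subrr.
  have D30 (u : 'rV_n.+1) : (u *m D *m D *m D *m u^T) 0 0 = 0.
    have E1 := E0 (u *m D); have F1 := F0 (u *m D).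
    have S0 : (u *m D *m E *m (u *m D)^T) 0 0
            + (u *m D *m F *m (u *m D)^T) 0 0 = 0.
      have -> (a b : 'M[R]_1) : a 0 0 + b 0 0 = (a + b) 0 0 by rewrite mxE.
      by rewrite -mulmxDl -mulmxDr -(mulmxA u D) DEF mulmx0 mul0mx mxE.
    have /eqP := S0; rewrite paddr_eq0// => /andP[/eqP E2 /eqP F2].
    have : (u *m D *m (E - F) *m (u *m D)^T) 0 0 = 0.
      by rewrite mulmxBr mulmxBl mxE [X in _ + X]mxE E2 F2 subr0.
    by rewrite trmx_mul DT !mulmxA.
  have D3 : D *m D *m D = 0.
    apply: symmx_quad0; first by rewrite !trmx_mul DT !mulmxA.
    by move=> u; rewrite !mulmxA D30.
  have D2 : D *m D = 0.
    by apply: symmx_sqr0; rewrite ?trmx_mul ?DT// mulmxA D3 mul0mx.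
  by apply/eqP; rewrite -subr_eq0; apply/eqP; exact: symmx_sqr0.
move=> Apsd Bpsd AB; have [q [Fpsd FF]] := psdmx_sqrt_horner A.
have AF := suf _ Apsd q Fpsd FF.
rewrite AF; apply/esym; rewrite [A^T *m A](_ : _ = B^T *m B) in Fpsd FF *.
  exact: suf.
by case: Apsd Bpsd => -> _ [-> _].
Qed.

End mxabs_wf.

(* Main.v *)
(** The entries of X enter only through closed walks: E Tr X^(2p) is the sum of
    E[prod_t X(w_t, w_(t+1))] over the closed walks w of length 2p, and a walk
    contributes only if it visits each of its edges at least twice.  Group the
    walks by shape, i.e. by the pattern of coincidences of their vertices.  In a
    shape with k + 1 vertices, the k steps that discover a new vertex are paired
    with another visit of the same edge and contribute variances, and the other
    2(p - k) steps contribute sup norms.  The discovery steps form a Markov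
    chain with invariant measure s_i = sum_j E[X_ij^2], so AM-GM bounds the
    walks of that shape by A^(2k) B^(2(p-k)), where A and B are the two
    quantities of the theorem.

    It remains to bound the sum over shapes of x^k for x = A^2 / B^2.  There are
    at least r x^k walks of a given shape on r = x + O(p) vertices, so it is
    enough to count walks on r vertices without edges visited once.  Such a walk
    lifts to a path in the space of pairs (vertex, set of open edges), each step
    of which opens, closes or keeps an edge.  On sets of at most 2p edges the
    closing operator, and its adjoint the opening operator, have norm at most
    sqrt(r + 4p), and the keeping operator has norm at most sqrt(4p), which
    yields the count r (2 sqrt(r + 4p) + 2 sqrt p)^(2p). *)

Require Import Defs.
From HB Require Import structures.
From mathcomp Require Import all_boot all_order all_algebra.
From mathcomp Require Import reals.
From mathcomp Require Import ring lra zify.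

Set Implicit Arguments.
Unset Strict Implicit.
Unset Printing Implicit Defensive.

Import Order.TTheory GRing.Theory Num.Theory.

Local Open Scope ring_scope.

(** * Norms of the operators on lifted walks *)

Lemma eq_set2 (T : finType) (a b c d : T) :
  ([set a; b] == [set c; d]) = (a == c) && (b == d) || (a == d) && (b == c).
Proof.
apply/eqP/idP => [E|].
  have h x : (x == a) || (x == b) = (x == c) || (x == d).
    by rewrite -!in_set2 E.
  have := h a; have := h b; have := h c; have := h d; rewrite !eqxx ?orbT/=.
  rewrite [d == a]eq_sym [d == b]eq_sym [c == a]eq_sym [c == b]eq_sym.
  by case: (a == c); case: (b == d); case: (a == d); case: (b == c).
by case/orP => /andP[/eqP-> /eqP->]//; rewrite setUC.
Qed.

Section LiftedWalks.
Variables (R : realFieldType) (V : finType).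
Implicit Types (j k : V) (S : {set {set V}}) (f g : V -> {set {set V}} -> R).

(** A loop at [j] is the singleton [[set j; j]] and counts once; members of [S] that are neither
    singletons nor pairs count nowhere. *)
Definition deg S j : nat := #|[set k | [set j; k] \in S]|.

(** Handshake: a set is of the form [[set j; k]] for at most two ordered pairs. *)
Lemma sum_deg S : (\sum_j deg S j <= 2 * #|S|)%N.
Proof.
have -> : (\sum_j deg S j = \sum_j \sum_k \sum_(e in S) (e == [set j; k]))%N.
  apply: eq_bigr => j _; rewrite /deg -sum1_card big_mkcond /=.
  apply: eq_bigr => k _; rewrite inE; case: ifPn => jkS.
    rewrite (bigD1 [set j; k])//= eqxx big1// => e /andP[_ /negbTE->//].
  by rewrite big1// => e eS; case: eqP eS jkS => // -> ->.
rewrite (eq_bigr (fun j => \sum_(e in S) \sum_k (e == [set j; k]))%N); last first.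
  by move=> j _; rewrite exchange_big.
rewrite exchange_big /= mulnC -sum_nat_const leq_sum// => e _.
rewrite pair_bigA /=.
have [/existsP[[j0 k0] /eqP/= eE]|/existsPn e0] :=
    boolP [exists x : V * V, e == [set x.1; x.2]]; last first.
  by rewrite big1// => x _; rewrite (negbTE (e0 x)).
rewrite -big_mkcond/= sum1_card; apply: (@leq_trans #|[set (j0, k0); (k0, j0)]|).
  apply/subset_leq_card/subsetP => -[j k] E.
  have : e == [set j; k] by exact: E.
  by rewrite eE eq_set2 !inE !xpair_eqE ![_ == j]eq_sym ![_ == k]eq_sym [X in _ || X]andbC.
by rewrite cards2; case: eqP.
Qed.

Definition sqnorm f : R := \sum_j \sum_S f j S ^+ 2.

(** Here [f j S] is thought of as the number of continuations of a walk at [j] with open edges [S],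
    so each operator evaluates [f] at the state after the step. *)
Definition close_edge f j S : R :=
  \sum_(k | [set j; k] \in S) f k (S :\ [set j; k]).
Definition open_edge f j S : R :=
  \sum_(k | [set j; k] \notin S) f k ([set j; k] |: S).
Definition keep_edge f j S : R := \sum_(k | [set j; k] \in S) f k S.

(** Cauchy-Schwarz against the constant 1, from the positivity of the double sum of
    [(x i - x j) ^+ 2]. *)
Lemma sqr_sum_le (I : finType) (P : pred I) (x : I -> R) :
  (\sum_(i | P i) x i) ^+ 2 <= #|P|%:R * \sum_(i | P i) x i ^+ 2.
Proof.
set s := \sum_(i | P i) x i; set q := \sum_(i | P i) x i ^+ 2; set n := #|P|%:R.
have : 0 <= \sum_(i | P i) \sum_(j | P j) (x i - x j) ^+ 2.
  by apply: sumr_ge0 => i _; apply: sumr_ge0 => j _; exact: sqr_ge0.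
have E i : \sum_(j | P j) (x i - x j) ^+ 2 = n * x i ^+ 2 - 2 * s * x i + q.
  under eq_bigr do rewrite sqrrB.
  rewrite big_split sumrB/= sumr_const -[_ *+ #|P|]mulr_natl; congr (_ - _ + _).
  by rewrite /s mulr_sumr mulr_suml; apply: eq_bigr => j _; ring.
under eq_bigr do rewrite E.
rewrite big_split sumrB/= sumr_const -!mulr_sumr -/s -/q -(mulr_natl q) -/n.
lra.
Qed.

Lemma mulr_le_sqr (x y c : R) : 0 < c -> 2 * (x * y) <= x ^+ 2 / c + c * y ^+ 2.
Proof.
move=> c0; rewrite -subr_ge0.
have -> : x ^+ 2 / c + c * y ^+ 2 - 2 * (x * y) = (x - c * y) ^+ 2 / c.
  by field; rewrite gt_eqF.
by rewrite divr_ge0 ?sqr_ge0// ltW.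
Qed.

Lemma degU1 S j k : (deg ([set j; k] |: S) j <= (deg S j).+1)%N.
Proof.
rewrite /deg.
rewrite (leq_trans (subset_leq_card (_ : _ \subset k |: [set k | [set j; k] \in S])))//; last first.
  by rewrite cardsU1; case: (k \notin _) => /=; lia.
apply/subsetP => l; rewrite !inE eq_set2 eqxx /= => /orP[/orP[->//|/andP[/eqP -> /eqP ->]]|->].
  by rewrite eqxx.
by rewrite orbT.
Qed.

Variable L : nat.

(** On such a support the degrees sum to at most [2 * L], which is what bounds the operators. *)
Definition supp_le f := forall j S, (L < #|S|)%N -> f j S = 0.

Lemma sum_S_setU1 j k (F : {set {set V}} -> R) :
  \sum_(S : {set {set V}} | [set j; k] \in S) F (S :\ [set j; k]) =
  \sum_(S : {set {set V}} | [set j; k] \notin S) F S.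
Proof.
rewrite [RHS](reindex_onto (fun S => S :\ [set j; k]) (fun S => [set j; k] |: S)); last first.
  by move=> S /= H; rewrite setU1K.
apply: eq_bigl => S /=; rewrite !inE eqxx /=.
apply/idP/eqP => [/setD1K//|<-]; exact: setU11.
Qed.

(** Cauchy-Schwarz over [k] costs [deg S j]. In terms of the set left after the removal this is at
    most its degree plus one, and the sum over [j] gives [#|V| + 2 * L]. *)
Lemma close_edge_le f : supp_le f ->
  sqnorm (close_edge f) <= (#|V| + 2 * L)%:R * sqnorm f.
Proof.
move=> fL; rewrite /sqnorm /close_edge.
apply: (@le_trans _ R (\sum_(j : V) \sum_(S : {set {set V}}) \sum_(k : V | [set j; k] \in S)
   (deg S j)%:R * f k (S :\ [set j; k]) ^+ 2)).
  apply: ler_sum => j _; apply: ler_sum => S _.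
  apply: le_trans (sqr_sum_le _ _) _; rewrite mulr_sumr /deg cardsE lexx//.
apply: (@le_trans _ R (\sum_(j : V) \sum_(k : V) \sum_(S : {set {set V}} | [set j; k] \notin S)
   ((deg S j).+1)%:R * f k S ^+ 2)).
  apply: ler_sum => j _; rewrite [leLHS](exchange_big_dep predT)//=.
  apply: ler_sum => k _; rewrite -sum_S_setU1; apply: ler_sum => S jkS.
  apply: ler_wpM2r; first exact: sqr_ge0.
  by rewrite ler_nat -{1}(setD1K jkS) degU1.
rewrite exchange_big /= mulr_sumr; apply: ler_sum => k _.
rewrite (exchange_big_dep predT)//= mulr_sumr; apply: ler_sum => S _.
rewrite -mulr_suml.
have [SL|/fL->] := leqP #|S| L; last by rewrite expr0n !mulr0.
apply: ler_wpM2r; first exact: sqr_ge0.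
rewrite -natr_sum ler_nat.
apply: (@leq_trans (\sum_j (deg S j).+1)).
  by rewrite [leqRHS](bigID (fun j => [set j; k] \notin S))/= leq_addr.
under eq_bigr do rewrite -addn1.
by rewrite big_split/= sum_nat_const muln1 addnC leq_add2l (leq_trans (sum_deg S))// leq_mul2l.
Qed.

(** For fixed [S] the operator is the adjacency matrix of [S], whose squared Hilbert-Schmidt norm is
    the sum of the degrees. *)
Lemma keep_edge_le f : supp_le f ->
  sqnorm (keep_edge f) <= (2 * L)%:R * sqnorm f.
Proof.
move=> fL; rewrite /sqnorm /keep_edge.
rewrite exchange_big/= [in leRHS]exchange_big/= mulr_sumr; apply: ler_sum => S _.
have [SL|SL] := leqP #|S| L; last first.
  by rewrite !big1 ?mulr0// => j _; rewrite ?big1 ?fL ?expr0n// => k _; rewrite fL.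
apply: (@le_trans _ R (\sum_(j : V) (deg S j)%:R * \sum_(k : V) f k S ^+ 2)).
  apply: ler_sum => j _; apply: le_trans (sqr_sum_le _ _) _.
  rewrite /deg cardsE ler_wpM2l// [leRHS](bigID (fun k => [set j; k] \in S))/= lerDl.
  by apply: sumr_ge0 => k _; exact: sqr_ge0.
rewrite -mulr_suml ler_wpM2r//; first by apply: sumr_ge0 => k _; exact: sqr_ge0.
by rewrite -natr_sum ler_nat (leq_trans (sum_deg S))// leq_mul2l.
Qed.

Lemma open_close_adjoint f g :
  \sum_j \sum_S open_edge f j S * g j S = \sum_j \sum_S f j S * close_edge g j S.
Proof.
rewrite /open_edge /close_edge.
under eq_bigr do under eq_bigr do rewrite mulr_suml.
under [RHS]eq_bigr do under eq_bigr do rewrite mulr_sumr.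
under eq_bigr do rewrite (exchange_big_dep predT)//=.
rewrite exchange_big /=; apply: eq_bigr => k _.
rewrite [RHS](exchange_big_dep predT)//=; apply: eq_bigr => j _.
rewrite setUC.
rewrite -(sum_S_setU1 k j (fun S => f k ([set k; j] |: S) * g j S)).
by apply: eq_bigr => S kjS; rewrite setD1K.
Qed.

Lemma open_edge_supp f : supp_le f -> supp_le (open_edge f).
Proof.
move=> fL j S SL; apply: big1 => k _; apply: fL.
by apply: leq_trans SL _; apply/subset_leq_card/subsetUr.
Qed.

Lemma sqnorm_ge0 f : 0 <= sqnorm f.
Proof. by apply: sumr_ge0 => j _; apply: sumr_ge0 => S _; exact: sqr_ge0. Qed.

(** An operator and its adjoint have the same norm, and [open_edge f] keeps the support condition of
    [close_edge_le]. *)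
Lemma open_edge_le f : supp_le f ->
  sqnorm (open_edge f) <= (#|V| + 2 * L)%:R * sqnorm f.
Proof.
move=> fL; set c := (_ + _)%:R; set g := open_edge f.
(* The weight [c] in [mulr_le_sqr] has to be positive; it vanishes only if [V] is empty. *)
have [c0|c0] := eqVneq c 0.
  move: c0; rewrite /c => /eqP; rewrite pnatr_eq0 addn_eq0 => /andP[/eqP V0 _].
  rewrite /sqnorm !big1 ?mulr0// => j; have := card0_eq V0 j; by rewrite inE.
have cp : 0 < c by rewrite lt_def c0 /c /=.
(* |g|^2 = <f, close_edge g> by duality. *)
have H : sqnorm g <= (2^-1) * (sqnorm (close_edge g) / c + c * sqnorm f).
  rewrite {1}/sqnorm; under eq_bigr do under eq_bigr do rewrite expr2.
  rewrite open_close_adjoint /sqnorm mulr_suml mulr_sumr -big_split mulr_sumr/=.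
  apply: ler_sum => j _; rewrite mulr_suml mulr_sumr -big_split mulr_sumr/=.
  apply: ler_sum => S _; set x := close_edge g j S; set y := f j S.
  have := mulr_le_sqr x y cp; lra.
have := close_edge_le (open_edge_supp fL); rewrite -/c -/g.
rewrite -ler_pdivrMl// mulrC; move: H; lra.
Qed.

Definition lift_step f j S := close_edge f j S + open_edge f j S + keep_edge f j S.

(** The triangle inequality for three operators of norms at most [a], [a] and [b], in a form without
    square roots: [(x + y + z) ^+ 2] is at most [(2 * a + b) * (x ^+ 2 / a + y ^+ 2 / a + z ^+ 2 /
    b)]. *)
Lemma lift_step_le (a b : R) f : 0 < a -> 0 < b -> supp_le f ->
  (#|V| + 2 * L)%:R <= a ^+ 2 -> (2 * L)%:R <= b ^+ 2 ->
  sqnorm (lift_step f) <= (2 * a + b) ^+ 2 * sqnorm f.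
Proof.
move=> a0 b0 fL ha hb.
have H : sqnorm (lift_step f) <= (2 * a + b) *
   (sqnorm (close_edge f) / a + sqnorm (open_edge f) / a + sqnorm (keep_edge f) / b).
  rewrite /sqnorm !mulr_suml -!big_split mulr_sumr/=.
  apply: ler_sum => j _; rewrite !mulr_suml -!big_split mulr_sumr/=.
  apply: ler_sum => S _; rewrite /lift_step.
  set x := close_edge f j S; set y := open_edge f j S; set z := keep_edge f j S.
  rewrite -subr_ge0.
  have -> : (2 * a + b) * (x ^+ 2 / a + y ^+ 2 / a + z ^+ 2 / b) - (x + y + z) ^+ 2
    = (x - y) ^+ 2 + (b * x - a * z) ^+ 2 / (a * b) + (b * y - a * z) ^+ 2 / (a * b).
    by field; rewrite !gt_eqF.
  by rewrite !addr_ge0 ?sqr_ge0// divr_ge0 ?sqr_ge0// mulr_ge0// ltW.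
apply: le_trans H _; rewrite expr2 -mulrA ler_wpM2l; [by []|lra|].
have N0 := sqnorm_ge0 f.
have aN : a ^+ 2 * sqnorm f / a = a * sqnorm f by field; rewrite gt_eqF.
have bN : b ^+ 2 * sqnorm f / b = b * sqnorm f by field; rewrite gt_eqF.
have h1 : sqnorm (close_edge f) / a <= a * sqnorm f.
  rewrite -aN ler_wpM2r ?invr_ge0 ?(ltW a0)// (le_trans (close_edge_le fL))//.
  by rewrite ler_wpM2r.
have h2 : sqnorm (open_edge f) / a <= a * sqnorm f.
  rewrite -aN ler_wpM2r ?invr_ge0 ?(ltW a0)// (le_trans (open_edge_le fL))//.
  by rewrite ler_wpM2r.
have h3 : sqnorm (keep_edge f) / b <= b * sqnorm f.
  rewrite -bN ler_wpM2r ?invr_ge0 ?(ltW b0)// (le_trans (keep_edge_le fL))//.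
  by rewrite ler_wpM2r.
lra.
Qed.

End LiftedWalks.

(** * Counting closed walks without edges visited once *)

Lemma big_tuple0 (R : nmodType) (V : finType) (F : seq V -> R) :
  \sum_(q : 0.-tuple V) F q = F [::].
Proof.
by rewrite (big_pred1 [tuple])// => q; rewrite [q]tuple0; exact/esym/eqP.
Qed.

Lemma big_tuple_thead (R : nmodType) (V : finType) t (F : t.+1.-tuple V -> R) :
  \sum_q F q = \sum_k \sum_(q : t.-tuple V) F [tuple of k :: q].
Proof.
rewrite pair_bigA /=.
rewrite (reindex (fun kq : V * t.-tuple V => [tuple of kq.1 :: kq.2]))//=.
exists (fun q => (thead q, [tuple of behead q])) => [[k q] _|q _] /=.
  by rewrite theadE; congr pair; exact: val_inj.
by rewrite [RHS]tuple_eta.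
Qed.

Lemma big_tuple_cons (R : nmodType) (V : finType) t (F : seq V -> R) :
  \sum_(q : t.+1.-tuple V) F q = \sum_k \sum_(q : t.-tuple V) F (k :: q).
Proof. exact: big_tuple_thead. Qed.

Lemma big_tuple_rcons (R : nmodType) (V : finType) t (F : seq V -> R) :
  \sum_(q : t.+1.-tuple V) F q = \sum_(q : t.-tuple V) \sum_k F (rcons q k).
Proof.
elim: t F => [|t IH] F.
  rewrite big_tuple_cons (big_tuple0 (fun q => \sum_k F (rcons q k))); apply: eq_bigr => k _.
  by rewrite (big_tuple0 (fun q => F (k :: q))).
rewrite big_tuple_cons; under eq_bigr do rewrite (IH (fun q => F (cons _ q))).
by rewrite (big_tuple_cons _ (fun q => \sum_k F (rcons q k))).
Qed.

Section CountWalks.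
Variables (R : realFieldType) (V : finType).
Implicit Types (i j k : V) (S : {set {set V}}) (q : seq V).

Fixpoint walk_edges j q : seq {set V} :=
  if q is k :: q' then [set j; k] :: walk_edges k q' else [::].

Lemma size_walk_edges j q : size (walk_edges j q) = size q.
Proof. by elim: q j => //= k q IH j; rewrite IH. Qed.

(* The edges of S were opened by the past of the walk: they have to be visited *)
(* again, whereas the other edges must not be visited exactly once.            *)
Definition completes i j S q :=
  (last j q == i) && [forall e, if e \in S then (0 < count_mem e (walk_edges j q))%N
                                 else count_mem e (walk_edges j q) != 1%N].

Definition num_walks t i j S : R := \sum_(q : t.-tuple V) (completes i j S q)%:R.

Lemma num_walks_ge0 t i j S : 0 <= num_walks t i j S.
Proof. by apply: sumr_ge0. Qed.

(** The first edge is opened if it is not in [S]; otherwise it is closed if the rest of the walk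
    avoids it, and kept if the rest visits it again. A rest that visits it at least twice may be
    counted under both closing and keeping, hence only an inequality. *)
Lemma num_walksS t i j S :
  num_walks t.+1 i j S <= lift_step (num_walks t i) j S.
Proof.
rewrite /num_walks (big_tuple_cons _ (fun q => (completes i j S q)%:R)).
rewrite (bigID (fun k => [set j; k] \in S))/= /lift_step addrAC lerD//.
  rewrite /close_edge /keep_edge -big_split ler_sum//= => k jkS.
  rewrite -big_split ler_sum//= => q _; rewrite /completes/=.
  case: eqP => //= _; last by rewrite lerDl.
  case: forallP => // H; last by rewrite addr_ge0.
  have [c0|c0] := posnP (count_mem [set j; k] (walk_edges k q)).
    case: forallP => [_|[]]; first by rewrite lerDl.
    move=> e; have := H e; rewrite in_setD1.
    by have [->|] := eqVneq e [set j; k]; first by rewrite /= c0.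
  case: (boolP [forall e, if e \in S then _ else _]) => [_|/forallP[]].
    by rewrite lerDr.
  move=> e; have := H e.
  by have [->|] := eqVneq e [set j; k]; first by rewrite jkS c0.
rewrite /open_edge ler_sum//= => k jkS; rewrite ler_sum// => q _.
rewrite /completes/=.
case: eqP => //= _; case: forallP => // H.
case: forallP => // -[] e; have := H e; rewrite in_setU1.
have [->|//] := eqVneq e [set j; k].
by rewrite (negbTE jkS); case: (count_mem _ _).
Qed.

Lemma num_walks_supp L t i : (t <= L)%N -> supp_le L (num_walks t i).
Proof.
move=> tL j S LS; apply: big1 => q _; rewrite /completes.
case: forallP => [H|]; last by rewrite andbF.
suff : (#|S| <= t)%N by lia.
rewrite -(size_tuple q) -(size_walk_edges j).
apply: leq_trans (card_size _); apply/subset_leq_card/subsetP => e eS.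
by have := H e; rewrite eS -has_count has_pred1.
Qed.

Lemma ler_sqnorm (f g : V -> {set {set V}} -> R) :
  (forall j S, 0 <= f j S <= g j S) -> sqnorm f <= sqnorm g.
Proof.
move=> fg; apply: ler_sum => j _; apply: ler_sum => S _.
by have /andP[f0 fgS] := fg j S; rewrite lerXn2r// nnegrE// (le_trans f0).
Qed.

(** Iterates [lift_step_le] from the indicator of the state [(i, set0)], which has norm 1. *)
Lemma sqnorm_num_walks (a b : R) L t i : 0 < a -> 0 < b ->
  (#|V| + 2 * L)%:R <= a ^+ 2 -> (2 * L)%:R <= b ^+ 2 -> (t <= L)%N ->
  sqnorm (num_walks t i) <= (2 * a + b) ^+ (2 * t).
Proof.
move=> a0 b0 ha hb; elim: t => [|t IH] tL.
  have n0 j S : num_walks 0 i j S = ((j == i) && (S == set0))%:R.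
    rewrite /num_walks (big_tuple0 (fun q => (completes i j S q)%:R)).
    rewrite /completes/=; congr (_ && _)%:R.
    apply/forallP/eqP => [H|-> e]; last by rewrite inE.
    by apply/setP => e; rewrite inE; have := H e; case: (e \in S).
  rewrite /sqnorm (bigD1 i)//= (bigD1 set0)//= !n0 !eqxx expr1n !big1 ?addr0 ?expr0//.
    by move=> j /negbTE ji; rewrite big1// => S _; rewrite n0 ji expr0n.
  by move=> S /negbTE S0; rewrite n0 S0 andbF expr0n.
apply: le_trans (_ : sqnorm (lift_step (num_walks t i)) <= _).
  by apply: ler_sqnorm => j S; rewrite num_walks_ge0 num_walksS.
have fL : supp_le L (num_walks t i) by apply: num_walks_supp; exact: ltnW.
apply: le_trans (lift_step_le a0 b0 fL ha hb) _.
by rewrite mulnS exprD ler_wpM2l ?sqr_ge0// IH// ltnW.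
Qed.

Lemma num_walks_le (a b : R) L i : 0 < a -> 0 < b ->
  (#|V| + 2 * L)%:R <= a ^+ 2 -> (2 * L)%:R <= b ^+ 2 ->
  num_walks L i i set0 <= (2 * a + b) ^+ L.
Proof.
move=> a0 b0 ha hb.
have := sqnorm_num_walks i a0 b0 ha hb (leqnn L).
rewrite mulnC exprM => H.
rewrite -(@ler_pXn2r _ 2) ?nnegrE ?num_walks_ge0//; last first.
  by rewrite exprn_ge0// addr_ge0// ?mulr_ge0// ltW.
apply: le_trans H; rewrite /sqnorm (bigD1 i)//= (bigD1 set0)//= -addrA lerDl.
rewrite addr_ge0//; first by apply: sumr_ge0 => S _; exact: sqr_ge0.
by apply: sumr_ge0 => j _; apply: sumr_ge0 => S _; exact: sqr_ge0.
Qed.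

End CountWalks.

(** The cyclic successor [ordS] closes the walk: its last edge leads back to the start. *)
Definition walk_edge (V : finType) L (w : L.-tuple V) (t : 'I_L) : {set V} :=
  [set tnth w t; tnth w (ordS t)].

Definition no_single_edge (V : finType) L (w : L.-tuple V) :=
  [forall t, 1 < #|[set t' | walk_edge w t' == walk_edge w t]|]%N.

Lemma tnth_cons_ordS (V : Type) l (i d : V) (q : l.-tuple V) (t : 'I_l.+1) :
  tnth [tuple of i :: q] (ordS t) = nth d (rcons q i) t.
Proof.
rewrite (tnth_nth d) /= nth_rcons size_tuple.
have [->|tNl] := eqVneq (t : nat) l; first by rewrite modnn ltnn.
have tl : (t < l)%N by rewrite ltn_neqAle tNl -ltnS /=.
by rewrite tl modn_small.
Qed.

Lemma nth_walk_edges (V : finType) (d j : V) q t : (t < size q)%N ->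
  nth set0 (walk_edges j q) t = [set nth d (j :: q) t; nth d q t].
Proof. by elim: q j t => // k q IH j [//|t] /= tq; rewrite IH. Qed.

Lemma walk_edges_closed (V : finType) l i (q : l.-tuple V) :
  walk_edges i (rcons q i) =
  [seq walk_edge [tuple of i :: q] t | t <- enum 'I_l.+1].
Proof.
apply: (@eq_from_nth _ set0) => [|t].
  by rewrite size_walk_edges size_rcons size_map size_enum_ord size_tuple.
rewrite size_walk_edges size_rcons size_tuple => tl.
rewrite (nth_walk_edges i) ?size_rcons ?size_tuple//.
rewrite (nth_map ord0) ?size_enum_ord// -[t]/(nat_of_ord (Ordinal tl)) nth_ord_enum.
rewrite /walk_edge (tnth_cons_ordS _ i) (tnth_nth i).
by rewrite -rcons_cons nth_rcons /= size_tuple tl.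
Qed.

(** For each starting vertex, a closed walk without single edges is a return to that vertex that
    completes the empty set. *)
Lemma card_no_single_edge (R : realFieldType) (V : finType) (a b : R) L :
  (0 < L)%N -> 0 < a -> 0 < b ->
  (#|V| + 2 * L)%:R <= a ^+ 2 -> (2 * L)%:R <= b ^+ 2 ->
  #|[set w : L.-tuple V | no_single_edge w]|%:R <= #|V|%:R * (2 * a + b) ^+ L.
Proof.
case: L => // l _ a0 b0 ha hb.
have -> : #|[set w : l.+1.-tuple V | no_single_edge w]|%:R =
   \sum_(w : l.+1.-tuple V) (no_single_edge w)%:R :> R.
  rewrite -sum1_card natr_sum big_mkcond/=; apply: eq_bigr => w _.
  by rewrite inE; case: no_single_edge.
apply: (@le_trans _ _ (\sum_(i : V) num_walks R l.+1 i i set0)); last first.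
  rewrite mulr_natl -sumr_const; apply: ler_sum => i _; exact: num_walks_le.
rewrite big_tuple_thead.
apply: ler_sum => i _; rewrite /num_walks.
rewrite (big_tuple_rcons _ (fun q => (completes i i set0 q)%:R)) exchange_big/=.
(* Of all the last vertices only the return to [i] is kept; the other terms are nonnegative. *)
rewrite [leRHS](bigD1 i)//= -[leLHS]addr0 lerD//; last first.
  by apply: sumr_ge0 => k _; apply: sumr_ge0.
apply: ler_sum => q _; case: (boolP (no_single_edge _)) => // /forallP H.
rewrite /completes last_rcons eqxx/=; case: forallP => // -[] e.
rewrite inE walk_edges_closed count_map; set w := [tuple of i :: q].
case: (pickP (fun t => walk_edge w t == e)) => [t /eqP te|no]; last first.
  by rewrite (@eq_count _ _ pred0) ?count_pred0//.
have := H t; rewrite -/w te -sum1_card -sum1_count big_enum_cond/=.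
rewrite (eq_bigl (fun t' => walk_edge w t' == e)) => [|t']; last by rewrite inE.
by case: (\sum_(i | _) 1)%N => [|[]].
Qed.

(** * Shapes of walks *)

Section Shape.
Variables (L : nat).
Implicit Types (V W : eqType).

Lemma first_visit_subproof V (w : L.-tuple V) (t : 'I_L) :
  (index (tnth w t) w < L)%N.
Proof. by rewrite -[ltnRHS](size_tuple w) index_mem mem_tnth. Qed.

(** A pattern of coincidences is encoded by a canonical walk, in which each vertex is replaced by
    the time of its first visit. Shapes are thus the fixed points of [shape]. *)
Definition shape V (w : L.-tuple V) : L.-tuple 'I_L :=
  [tuple Ordinal (first_visit_subproof w t) | t < L].

Lemma tnth_shape V (w : L.-tuple V) t : tnth w (tnth (shape w) t) = tnth w t.
Proof.
rewrite tnth_mktuple [LHS](tnth_nth (tnth w t))/= nth_index//.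
exact: mem_tnth.
Qed.

Lemma shape_le V (w : L.-tuple V) s t : tnth w s = tnth w t ->
  (tnth (shape w) t <= s)%N.
Proof.
rewrite tnth_mktuple/= => <-; rewrite (tnth_nth (tnth w s)).
by apply: index_nth; rewrite size_tuple.
Qed.

Lemma shape_eq V (w : L.-tuple V) s t :
  (tnth (shape w) s == tnth (shape w) t) = (tnth w s == tnth w t).
Proof.
apply/eqP/eqP => [E|E]; first by rewrite -tnth_shape E tnth_shape.
by rewrite !tnth_mktuple; apply: val_inj; rewrite /= E.
Qed.

Lemma eq_shape V W (w : L.-tuple V) (z : L.-tuple W) :
  (forall s t, (tnth w s == tnth w t) = (tnth z s == tnth z t)) ->
  shape w = shape z.
Proof.
move=> H; apply: eq_from_tnth => t; apply/val_inj/eqP; rewrite eqn_leq.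
apply/andP; split; apply: shape_le; apply/eqP.
- by rewrite H tnth_shape.
- by rewrite -H tnth_shape.
Qed.

Lemma shapeK V (w : L.-tuple V) : shape (shape w) = shape w.
Proof. by apply: eq_shape => s t; exact: shape_eq. Qed.

End Shape.

Lemma walk_edge_shape (V : finType) L (w : L.-tuple V) s t :
  (walk_edge (shape w) s == walk_edge (shape w) t) = (walk_edge w s == walk_edge w t).
Proof. by rewrite /walk_edge !eq_set2 !shape_eq. Qed.

Lemma no_single_edge_shape (V : finType) L (w : L.-tuple V) :
  no_single_edge (shape w) = no_single_edge w.
Proof.
apply: eq_forallb => t; congr (_ < _)%N; apply: eq_card => s.
by rewrite !inE walk_edge_shape.
Qed.

Definition new_times L (r : L.-tuple 'I_L) : {set 'I_L} := [set t | tnth r t == t].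

(** Distinct vertices chosen for the new times extend to a walk of shape [r], and different choices
    give different walks. *)
Lemma card_shape_ge (V : finType) L (r : L.-tuple 'I_L) : shape r = r ->
  (#|V| ^_ #|new_times r| <= #|[set w : L.-tuple V | shape w == r]|)%N.
Proof.
move=> rK; pose D := {t : 'I_L | tnth r t == t}.
have Dcard : #|new_times r| = #|{: D}| by rewrite card_sig; apply: eq_card => t; rewrite !inE.
rewrite Dcard -card_inj_ffuns.
have rP t : tnth r (tnth r t) == tnth r t by have := tnth_shape r t; rewrite rK => ->.
pose z (f : {ffun D -> V}) : L.-tuple V := [tuple f (exist _ (tnth r t) (rP t)) | t < L].
rewrite -(card_imset (f := z)); last first.
  move=> f g fg; apply/ffunP => -[t rt].
  have := congr1 (fun w => tnth w t) fg; rewrite !tnth_mktuple.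
  by rewrite (_ : exist _ _ _ = exist _ t rt)//; apply: val_inj; exact/eqP.
apply/subset_leq_card/subsetP => w /imsetP[f]; rewrite !inE => /injectiveP f_inj ->.
rewrite -[eqbRHS]rK; apply/eqP/eq_shape => s t; rewrite !tnth_mktuple.
apply/eqP/eqP => [/f_inj/(congr1 val)//|E]; congr (f _); exact: val_inj.
Qed.

(** Each factor [r - i] with [i < m] is at least [x]. In the induction [M] and [r] decrease
    together. *)
Lemma ffact_ge (R : numDomainType) (x : R) r m M : 0 <= x -> (m <= M)%N ->
  x + M%:R <= r%:R -> x ^+ m <= (r ^_ m)%:R.
Proof.
move=> x0; elim: m M r => [|m IH] M r mM H; first by rewrite ffactn0.
rewrite ffactnS exprS natrM ler_pM ?exprn_ge0//.
  by apply: le_trans H; rewrite lerDl.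
apply: (IH M.-1); first by lia.
case: M mM H => // M _; case: r => [|r].
  by move=> H; apply: le_trans H; rewrite lerD2l ler_nat.
by rewrite /= -!natr1 addrA lerD2r.
Qed.

(** Each shape with [k + 1] vertices is realized by at least [r * x ^+ k] walks on [r] vertices, so
    the count of walks bounds the sum over shapes; the factor [r] of the starting vertex cancels. *)
Lemma sum_shapes_le (R : realFieldType) L (x a b : R) (r : nat) :
  (0 < L)%N -> (0 < r)%N -> 0 <= x -> 0 < a -> 0 < b -> x + L%:R <= r%:R ->
  (r + 2 * L)%:R <= a ^+ 2 -> (2 * L)%:R <= b ^+ 2 ->
  \sum_(rho : L.-tuple 'I_L | (shape rho == rho) && no_single_edge rho)
     x ^+ (#|new_times rho|.-1) <= (2 * a + b) ^+ L.
Proof.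
move=> L0 r0 x0 a0 b0 xr ha hb.
rewrite -(ler_pM2l (_ : 0 < r%:R :> R)) ?ltr0n//.
apply: le_trans (_ : #|[set w : L.-tuple 'I_r | no_single_edge w]|%:R <= _); last first.
  by have := @card_no_single_edge R 'I_r a b L; rewrite card_ord; exact.
rewrite -sum1_card natr_sum mulr_sumr.
rewrite [leRHS](partition_big (@shape L _) (fun rho => (shape rho == rho) && no_single_edge rho))/=;
  last first.
   by move=> w; rewrite inE shapeK eqxx no_single_edge_shape.
apply: ler_sum => rho /andP[/eqP rK nse].
apply: (@le_trans _ _ #|[set w : L.-tuple 'I_r | shape w == rho]|%:R); last first.
  rewrite -sum1_card natr_sum le_eqVlt; apply/orP; left; apply/eqP.
  apply: eq_bigl => w; rewrite !inE; case: eqP => [E|]; last by rewrite andbF.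
  by rewrite -no_single_edge_shape E nse.
apply: le_trans (_ : (r ^_ #|new_times rho|)%:R <= _); last first.
  by rewrite ler_nat -[in leqLHS](card_ord r) card_shape_ge.
have n0 : (0 < #|new_times rho|)%N.
  apply/card_gt0P; exists (Ordinal L0); rewrite inE; apply/eqP/val_inj => /=.
  by apply/eqP; rewrite -leqn0 -[rho in leqLHS]rK; exact: (shape_le (s := Ordinal L0)).
(* The first factor of the falling factorial is [r] itself; the others start at [r - 1], which
   matches [M = L - 1]. *)
rewrite -[in leRHS](prednK n0) ffactnS natrM ler_wpM2l//.
have nL : (#|new_times rho| <= L)%N by rewrite -[leqRHS](card_ord L) max_card.
apply: (ffact_ge (M := L.-1)) => //; first by rewrite -!subn1 leq_sub2r.
by rewrite -(lerD2r 1) -addrA !natr1 !prednK.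
Qed.

(** * Sums over the walks of a given shape *)

Section AGM.
Variable R : realFieldType.

(** AM-GM for [2 * q] numbers: each [x i ^+ q] taken twice, each [y i ^+ (2 * q)] once. Variances
    thus weigh as much as two sup norms. *)
Lemma prod_le_mean (I : finType) (A B : {set I}) (x y : I -> R) (q : nat) :
  (2 * #|A| + #|B| = 2 * q)%N -> (0 < q)%N ->
  (forall i, 0 <= x i) -> (forall i, 0 <= y i) ->
  \prod_(i in A) x i * \prod_(i in B) y i <=
  (2 * \sum_(i in A) x i ^+ q + \sum_(i in B) y i ^+ (2 * q)) / (2 * q)%:R.
Proof.
move=> AB q0 x0 y0.
(* [J] is the disjoint union of two copies of [A] and one of [B]. *)
pose J := [set k : bool * bool * I | if k.1.1 then (k.2 \in A) else ~~ k.1.2 && (k.2 \in B)].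
pose E (k : bool * bool * I) : R := if k.1.1 then x k.2 ^+ q else y k.2 ^+ (2 * q).
have bigJ (S : Type) (idx : S) (op : Monoid.com_law idx) (F : bool * bool * I -> S) :
    \big[op/idx]_(k in J) F k =
    op (op (\big[op/idx]_(i in A) F (true, true, i))
           (\big[op/idx]_(i in A) F (true, false, i)))
       (\big[op/idx]_(i in B) F (false, false, i)).
  have -> : \big[op/idx]_(k in J) F k =
      \big[op/idx]_(b : bool * bool) \big[op/idx]_(i | (b, i) \in J) F (b, i).
    by rewrite pair_big_dep/=; apply: eq_big => [[b i]|[b i] _].
  have -> (G : bool * bool -> S) : \big[op/idx]_(b : bool * bool) G b =
      \big[op/idx]_(b : bool) \big[op/idx]_(c : bool) G (b, c).
    by rewrite pair_bigA/=; apply: eq_bigr => -[].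
  rewrite !big_bool/=; congr (op (op _ _) _).
  - by apply: eq_bigl => i; rewrite inE.
  - by apply: eq_bigl => i; rewrite inE.
  rewrite big_pred0 ?Monoid.mul1m; last by move=> i; rewrite inE.
  by apply: eq_bigl => i; rewrite inE.
have Jcard : #|J| = (2 * q)%N.
  by rewrite -sum1_card bigJ !sum1_card -AB/=; lia.
have E0 k : 0 <= E k by rewrite /E; case: ifP => _; rewrite exprn_ge0.
have [+ _] := @leif_AGM R _ (mem J) E (fun k _ => E0 k); rewrite Jcard => H.
have sumE : \sum_(k in J) E k = 2 * \sum_(i in A) x i ^+ q + \sum_(i in B) y i ^+ (2 * q).
  by rewrite bigJ/= mulr2n mulrDl !mul1r.
have prodE : \prod_(k in J) E k = (\prod_(i in A) x i * \prod_(i in B) y i) ^+ (2 * q).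
  rewrite bigJ/= exprMn !prodrXl; congr (_ * _).
  by rewrite -expr2 -exprM mulnC.
rewrite -(@ler_pXn2r _ (2 * q)) ?nnegrE ?muln_gt0//; last 2 first.
- by rewrite mulr_ge0 ?prodr_ge0.
- rewrite divr_ge0// addr_ge0 ?mulr_ge0 ?sumr_ge0// => i _; exact: exprn_ge0.
by rewrite -prodE -sumE.
Qed.

Lemma mulXn_le_mean (x y : R) (p : nat) : (0 < p)%N -> 0 <= x -> 0 <= y ->
  x * y ^+ (2 * p.-1) <= (x ^+ p + p.-1%:R * y ^+ (2 * p)) / p%:R.
Proof.
move=> p0 x0 y0.
pose A := [set @None 'I_(2 * p.-1)]; pose B : {set option 'I_(2 * p.-1)} := [set~ None].
have A1 : #|A| = 1%N by rewrite cards1.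
have B1 : #|B| = (2 * p.-1)%N by rewrite /B cardsC1 card_option/=; exact: card_ord.
have := @prod_le_mean _ A B (fun=> x) (fun=> y) p.
rewrite !prodr_const !sumr_const A1 B1 => H.
apply: le_trans (H _ p0 _ _) _ => //; first by clear -p0; lia.
rewrite mulr1n natrM invfM mulrA ler_wpM2r ?invr_ge0//.
rewrite -[y ^+ (2 * p) *+ _]mulr_natr natrM; clear; lra.
Qed.

End AGM.

(** * The Markov chain of the discovery steps *)

Section Markov.
Variables (R : realFieldType) (V : finType) (v0 : V).
Variable a : V -> V -> R.
Hypothesis a_ge0 : forall i j, 0 <= a i j.
Hypothesis a_sym : forall i j, a i j = a j i.

Definition row_sum i := \sum_j a i j.
(** On a null row the quotient is 0, so the kernel is only sub-Markov. *)
Definition kernel i j := a i j / row_sum i.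

Lemma row_sum_ge0 i : 0 <= row_sum i.
Proof. exact: sumr_ge0. Qed.

Lemma kernel_ge0 i j : 0 <= kernel i j.
Proof. by rewrite divr_ge0// row_sum_ge0. Qed.

Lemma row_sum_kernel i j : row_sum i * kernel i j = a i j.
Proof.
rewrite /kernel mulrC; have [s0|s0] := eqVneq (row_sum i) 0; last by rewrite divfK.
rewrite s0 mulr0; have /eqP := s0; rewrite psumr_eq0// => /allP/(_ j).
by rewrite mem_index_enum => /(_ isT)/eqP ->.
Qed.

Lemma sum_kernel_le1 i : \sum_j kernel i j <= 1.
Proof.
rewrite -mulr_suml -/(row_sum i).
by have [->|s0] := eqVneq (row_sum i) 0; rewrite ?mul0r ?ler01// divff.
Qed.

(* Detailed balance: row_sum i * kernel i j = a i j is symmetric. *)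
Lemma row_sum_invariant (g : V -> R) :
  \sum_i row_sum i * \sum_j kernel i j * g j = \sum_j row_sum j * g j.
Proof.
under eq_bigr do rewrite mulr_sumr.
rewrite exchange_big/=; apply: eq_bigr => j _.
by rewrite /row_sum mulr_suml; apply: eq_bigr => i _; rewrite mulrA row_sum_kernel a_sym.
Qed.

Variable rho : nat -> nat.
Hypothesis rho_le : forall t, (rho t <= t)%N.

(* A vertex that is new at time t is reached from the vertex at time t - 1:   *)
(* this makes the walk a Markov chain, except that at the other times it goes *)
(* back to its past.                                                          *)
Definition shape_step (f : nat -> V) t : R :=
  if t == 0%N then row_sum (f 0%N)
  else if rho t == t then kernel (f t.-1) (f t) else (f t == f (rho t))%:R.

(** The unnormalized law of the process started from [row_sum], the invariant measure. *)
Definition shape_mass (q : seq V) : R := \prod_(t < size q) shape_step (nth v0 q) t.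

Lemma shape_mass_ge0 q : 0 <= shape_mass q.
Proof.
apply: prodr_ge0 => t _; rewrite /shape_step; case: ifP => _; first exact: row_sum_ge0.
by case: ifP => _ //; exact: kernel_ge0.
Qed.

Lemma shape_mass_rcons q x :
  shape_mass (rcons q x) = shape_mass q * shape_step (nth v0 (rcons q x)) (size q).
Proof.
rewrite /shape_mass size_rcons big_ord_recr/=; congr (_ * _).
apply: eq_bigr => t _; rewrite /shape_step !nth_rcons ltn_ord.
rewrite (leq_ltn_trans (rho_le t))// (leq_ltn_trans (leq_pred t))//.
by case: (size q) t => [[]//|n] t /=.
Qed.

(** All one-time marginals are dominated by [row_sum]. When the last vertex is summed out, a new
    vertex is a kernel step, which preserves [row_sum] or loses mass, and an old vertex copies the
    one at time [rho T]. *)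
Lemma shape_mass_marginal T t (g : V -> R) : (t < T)%N -> (forall i, 0 <= g i) ->
  \sum_(q : T.-tuple V) shape_mass q * g (nth v0 q t) <= \sum_i row_sum i * g i.
Proof.
elim: T t g => // T IH t g tT g0.
rewrite (big_tuple_rcons _ (fun q => shape_mass q * g (nth v0 q t))).
have [T0|T0] := posnP T.
  subst T; case: t tT => // _.
  rewrite (big_tuple0 (fun q => \sum_k shape_mass (rcons q k) * g (nth v0 (rcons q k) 0))).
  by apply: ler_sum => i _; rewrite /shape_mass/= big_ord_recl big_ord0 mulr1.
(* Summing out the last vertex leaves a function [h] of the vertex at an earlier time [u], to which
   the induction hypothesis applies. *)
have red (h : V -> R) u : (u < T)%N -> (forall i, 0 <= h i) ->
   (forall q : T.-tuple V, \sum_x shape_step (nth v0 (rcons q x)) T * g (nth v0 (rcons q x) t)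
       <= h (nth v0 q u)) ->
   \sum_i row_sum i * h i <= \sum_i row_sum i * g i ->
   \sum_(q : T.-tuple V) \sum_x shape_mass (rcons q x) * g (nth v0 (rcons q x) t) <=
   \sum_i row_sum i * g i.
  move=> uT h0 H Hs; apply: le_trans Hs; apply: le_trans (IH u h uT h0).
  apply: ler_sum => q _; under eq_bigr do rewrite shape_mass_rcons size_tuple -mulrA.
  by rewrite -mulr_sumr ler_wpM2l// shape_mass_ge0.
have nthT (q : T.-tuple V) x : nth v0 (rcons q x) T = x.
  by rewrite nth_rcons size_tuple ltnn eqxx.
have nthlt (q : T.-tuple V) x u : (u < T)%N -> nth v0 (rcons q x) u = nth v0 q u.
  by move=> uT; rewrite nth_rcons size_tuple uT.
have TN0 : (T == 0)%N = false by apply/negbTE; rewrite -lt0n.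
have T1 : (T.-1 < T)%N by rewrite prednK.
have [rT|rT] := eqVneq (rho T) T.
  have st (q : T.-tuple V) x : shape_step (nth v0 (rcons q x)) T = kernel (nth v0 q T.-1) x.
    by rewrite /shape_step TN0 rT eqxx nthT nthlt.
  have [tE|tN] := eqVneq t T.
    apply: (red (fun i => \sum_j kernel i j * g j) T.-1) => //.
    - by move=> i; apply: sumr_ge0 => j _; rewrite mulr_ge0// kernel_ge0.
    - by move=> q; apply: ler_sum => x _; rewrite st tE nthT.
    - by rewrite row_sum_invariant.
  have tlt : (t < T)%N by rewrite ltn_neqAle tN -ltnS.
  apply: (red g t) => // q.
  under eq_bigr do rewrite st nthlt//.
  by rewrite -mulr_suml ler_piMl// sum_kernel_le1.
have rlt : (rho T < T)%N by rewrite ltn_neqAle rT rho_le.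
have st (q : T.-tuple V) x : shape_step (nth v0 (rcons q x)) T = (x == nth v0 q (rho T))%:R.
  by rewrite /shape_step TN0 (negbTE rT) nthT nthlt.
have [tE|tN] := eqVneq t T.
  apply: (red g (rho T)) => // q; rewrite tE; under eq_bigr do rewrite st nthT.
  rewrite (bigD1 (nth v0 q (rho T)))//= eqxx mul1r big1 ?addr0// => x /negbTE ->.
  by rewrite mul0r.
have tlt : (t < T)%N by rewrite ltn_neqAle tN -ltnS.
apply: (red g t) => // q; under eq_bigr do rewrite st nthlt//.
rewrite (bigD1 (nth v0 q (rho T)))//= eqxx mul1r big1 ?addr0// => x /negbTE ->.
by rewrite mul0r.
Qed.

End Markov.

(** A discovery is indexed by the step [t] that leads to the new vertex at time [ordS t]. The
    condition [0 < ordS t] excludes the closing step, since time 0 is always a first visit. *)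
Definition discoveries L (rho : L.-tuple 'I_L) : {set 'I_L} :=
  [set t | (0 < ordS t)%N && (tnth rho (ordS t) == ordS t)].

Lemma ordS_pos L (t : 'I_L) : (0 < ordS t)%N -> ordS t = t.+1 :> nat.
Proof.
case: L t => [[]//|L] t /=; have [tL|tL _] := eqVneq (t : nat) L.
  by rewrite tL modnn.
by rewrite modn_small//; have := ltn_ord t; lia.
Qed.

(** * The bound for a single shape *)

Section ShapeSum.
Variables (R : realFieldType) (V : finType).
Variable a : V -> V -> R.
Hypothesis a_ge0 : forall i j, 0 <= a i j.
Hypothesis a_sym : forall i j, a i j = a j i.
Variable beta : V -> R.
Hypothesis beta_ge0 : forall i, 0 <= beta i.
Variables (A B : R) (p : nat).
Hypotheses (A_gt0 : 0 < A) (B_gt0 : 0 < B) (p_gt0 : (0 < p)%N).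
Hypothesis sumA : \sum_i row_sum a i ^+ p <= A ^+ (2 * p).
Hypothesis sumB : \sum_i beta i ^+ (2 * p) <= B ^+ (2 * p).

Let L := (2 * p)%N.
Variable rho : L.-tuple 'I_L.
Hypothesis rhoK : shape rho = rho.

Let L_gt0 : (0 < L)%N.
Proof. by rewrite /L muln_gt0. Qed.

Let zero : 'I_L := Ordinal L_gt0.

Let rhon t := nth 0%N (map val rho) t.

Let rhonE (t : 'I_L) : rhon t = tnth rho t.
Proof. by rewrite /rhon (nth_map t) ?size_tuple// -tnth_nth. Qed.

Let tnth_rho_le (t : 'I_L) : (tnth rho t <= t)%N.
Proof. by rewrite -[rho in leqLHS]rhoK; exact: shape_le. Qed.

Let rhon_le t : (rhon t <= t)%N.
Proof.
have [tL|tL] := ltnP t L; last by rewrite /rhon nth_default ?size_map ?size_tuple.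
by rewrite -[t]/(nat_of_ord (Ordinal tL)) rhonE.
Qed.

Let rho_idem t : tnth rho (tnth rho t) = tnth rho t.
Proof. by have := tnth_shape rho t; rewrite rhoK. Qed.

(** On walks of shape [rho] all the indicators in [shape_mass] equal 1. *)
Lemma shape_massE v0 (w : L.-tuple V) : shape w = rho ->
  shape_mass v0 a rhon w = row_sum a (tnth w zero) *
    \prod_(t in discoveries rho) kernel a (tnth w t) (tnth w (ordS t)).
Proof.
move=> wrho; rewrite /shape_mass -(big_mkord xpredT) size_tuple big_mkord.
(* The factor of time [ordS t] is attached to step [t]; the closing step carries the initial factor
   and is split off. *)
rewrite (reindex_inj (@ordS_inj _)) [X in _ * X]big_mkcond.
rewrite (bigD1 (ord_pred zero)) // [X in _ * X](bigD1 (ord_pred zero)) //.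
rewrite ord_predK inE ord_predK {1}/shape_step. 
rewrite -[LHS]/(row_sum a (nth v0 w zero) * _) -[RHS]/(_ * (1 * _)) mul1r -tnth_nth.
congr (_ * _).
apply: eq_bigr => t tz; rewrite /shape_step inE.
have Spos : (0 < ordS t)%N.
  rewrite lt0n; apply: contraNneq tz => E.
  by apply/eqP; rewrite -[t]ordSK; congr ord_pred; exact: val_inj.
have nthw (u : 'I_L) : nth v0 w u = tnth w u by rewrite -tnth_nth.
have Sp : (ordS t).-1 = t by rewrite (ordS_pos Spos).
rewrite (gtn_eqF Spos) Spos rhonE Sp !nthw (inj_eq val_inj) andTb.
by case: ifP => // _; rewrite -wrho tnth_shape eqxx.
Qed.

(** Before its first discovery the walk cannot have left its start, since reaching another vertex
    would be an earlier discovery. *)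
Lemma first_discovery : discoveries rho != set0 ->
  exists2 t0, t0 \in discoveries rho &
    forall w : L.-tuple V, shape w = rho -> tnth w t0 = tnth w zero.
Proof.
move=> /set0Pn[t1 t1D].
case: (arg_minnP (fun t : 'I_L => t : nat) t1D) => t0 t0D t0min.
exists t0 => // w wrho; apply/eqP; rewrite -shape_eq wrho.
have rz : tnth rho zero = zero.
  by apply/val_inj/eqP; rewrite -leqn0; exact: (tnth_rho_le zero).
rewrite rz; apply/negPn/negP => u0.
have upos : (0 < tnth rho t0)%N.
  by rewrite lt0n; apply: contraNneq u0 => E; apply/eqP/val_inj.
have u0D : ord_pred (tnth rho t0) \in discoveries rho.
  by rewrite inE ord_predK rho_idem eqxx andbT.
have := t0min _ u0D; have := tnth_rho_le t0.
have := ordS_pos (t := ord_pred (tnth rho t0)); rewrite ord_predK => /(_ upos) ->.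
by move=> h1 h2; have := leq_ltn_trans h2 h1; rewrite ltnn.
Qed.

Lemma constant_shape : discoveries rho = set0 ->
  forall w : L.-tuple V, shape w = rho -> w = nseq_tuple L (tnth w zero).
Proof.
move=> D0 w wrho; apply: eq_from_tnth => t; rewrite tnth_nseq.
apply/eqP; rewrite -shape_eq wrho.
have rz : tnth rho zero = zero.
  by apply/val_inj/eqP; rewrite -leqn0; exact: (tnth_rho_le zero).
rewrite rz; apply/negPn/negP => u0.
have : ord_pred (tnth rho t) \in discoveries rho.
  rewrite inE ord_predK rho_idem eqxx andbT lt0n.
  by apply: contraNneq u0 => E; apply/eqP/val_inj.
by rewrite D0 inE.
Qed.

Let s' i := row_sum a i / A ^+ 2.
Let b' i := beta i / B.

Let s'_ge0 i : 0 <= s' i.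
Proof. by rewrite divr_ge0 ?row_sum_ge0// exprn_ge0// ltW. Qed.

Let b'_ge0 i : 0 <= b' i.
Proof. by rewrite divr_ge0// ltW. Qed.

Let sum_s' : \sum_i s' i ^+ p <= 1.
Proof.
under eq_bigr do rewrite /s' expr_div_n -exprM.
by rewrite -mulr_suml ler_pdivrMr ?exprn_gt0// mul1r.
Qed.

Let sum_b' : \sum_i b' i ^+ (2 * p) <= 1.
Proof.
under eq_bigr do rewrite /b' expr_div_n.
by rewrite -mulr_suml ler_pdivrMr ?exprn_gt0// mul1r.
Qed.

Let sE i : row_sum a i = A ^+ 2 * s' i.
Proof. by rewrite /s' mulrC divfK// expf_neq0// gt_eqF. Qed.

Let sum_s_s' : \sum_i row_sum a i * s' i ^+ p.-1 <= A ^+ 2.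
Proof.
under eq_bigr do rewrite sE -mulrA -exprS prednK//.
by rewrite -mulr_sumr ler_piMr// exprn_ge0// ltW.
Qed.

(** The mixed sum of [s'] and [b' ^+ (2 * p.-1)] splits by AM-GM into pure powers with weights
    [1 / p] and [(p - 1) / p]. *)
Let sum_s_b' : \sum_i row_sum a i * b' i ^+ (2 * p.-1) <= A ^+ 2.
Proof.
under eq_bigr do rewrite sE -mulrA.
rewrite -mulr_sumr ler_piMr//; first by rewrite exprn_ge0// ltW.
apply: (@le_trans _ _ (\sum_i (s' i ^+ p + p.-1%:R * b' i ^+ (2 * p)) / p%:R)).
  by apply: ler_sum => i _; exact: mulXn_le_mean.
rewrite -mulr_suml ler_pdivrMr ?ltr0n// mul1r big_split/= -mulr_sumr.
rewrite -[in leRHS](prednK p_gt0) -natr1 addrC lerD//.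
by rewrite ler_piMr.
Qed.

(** Each variance is [row_sum] times [kernel]. The kernels and one [row_sum] make up [shape_mass];
    the other factors have total weight [2 * (p - 1)] and are averaged against it. *)
Lemma sum_shape_le (E : {set 'I_L}) :
  (#|E| + 2 * #|discoveries rho| = 2 * p)%N ->
  \sum_(w : L.-tuple V | shape w == rho)
    (\prod_(t in discoveries rho) a (tnth w t) (tnth w (ordS t)) *
     \prod_(t in E) beta (tnth w t))
  <= A ^+ (2 * #|discoveries rho|) * B ^+ #|E|.
Proof.
move=> cardE.
have bE i : beta i = B * b' i by rewrite /b' mulrC divfK// gt_eqF.
have AB_ge0 m n : 0 <= A ^+ m * B ^+ n by rewrite mulr_ge0// exprn_ge0// ltW.
case: (pickP V) => [v0 _|V0]; last first.
  rewrite big1// => w; have := V0 (tnth w zero); by rewrite inE.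
(* Without discoveries only constant walks remain, and [sumB] bounds them directly. *)
have [D0|DN0] := eqVneq (discoveries rho) set0.
  rewrite D0 cards0 muln0 addn0 in cardE *; rewrite expr0 mul1r.
  apply: (@le_trans _ _ (\sum_(w : L.-tuple V) \sum_(i : V)
      if w == nseq_tuple L i then beta i ^+ #|E| else 0)).
    rewrite big_mkcond; apply: ler_sum => w _.
    have ge0 (P : pred V) : 0 <= \sum_(i | P i) if w == nseq_tuple L i then beta i ^+ #|E| else 0.
      by apply: sumr_ge0 => i _; case: ifP => // _; exact: exprn_ge0.
    case: eqP => // /(constant_shape D0) wE.
    rewrite (bigD1 (tnth w zero))//= (introT eqP wE) big_set0 mul1r.
    rewrite -[leLHS]addr0 lerD// le_eqVlt; apply/orP; left; apply/eqP.
    rewrite -prodr_const; apply: eq_bigr => t _; by rewrite {1}wE tnth_nseq.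
  rewrite exchange_big/= cardE; apply: le_trans sumB.
  by apply: ler_sum => i _; rewrite -big_mkcond big_pred1_eq.
have [t0 t0D t0E] := first_discovery DN0.
set D := discoveries rho in t0D DN0 cardE *.
have D1 := cardsD1 t0 D; rewrite t0D in D1.
set D' := D :\ t0 in D1.
have E1 : (2 * #|D'| + #|E| = 2 * p.-1)%N.
  move: cardE D1 p_gt0; move: (#|D|) (#|D'|) (#|E|) => x y z; clear; lia.
(* The [row_sum] at the first discovery [t0] is the one at the start, which is the initial factor of
   [shape_mass]. *)
have massE (w : L.-tuple V) : shape w = rho ->
   \prod_(t in D) a (tnth w t) (tnth w (ordS t)) =
   shape_mass v0 a rhon w * \prod_(t in D') row_sum a (tnth w t).
  move=> wrho; rewrite (shape_massE v0 wrho) -(t0E _ wrho) -/D.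
  under eq_bigr do rewrite -row_sum_kernel//.
  by rewrite big_split/= (big_setD1 t0 t0D)/= mulrAC.
have mass0 w : 0 <= shape_mass v0 a rhon w := shape_mass_ge0 v0 a_ge0 rhon w.
have marg (g : V -> R) (t : 'I_L) : (forall i, 0 <= g i) ->
    \sum_(w : L.-tuple V) shape_mass v0 a rhon w * g (tnth w t) <= \sum_i row_sum a i * g i.
  move=> g0; have := shape_mass_marginal v0 a_ge0 a_sym rhon_le (ltn_ord t) g0.
  by under eq_bigr do rewrite -tnth_nth.
(* AM-GM splits the remaining 2(p - 1) factors into powers of a single one,   *)
(* and these are summed with the marginals of the process.                    *)
pose G (w : L.-tuple V) : R := \prod_(t in D') s' (tnth w t) * \prod_(t in E) b' (tnth w t).
have G0 w : 0 <= G w by rewrite mulr_ge0// prodr_ge0.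
suff GA : \sum_(w : L.-tuple V) shape_mass v0 a rhon w * G w <= A ^+ 2.
  apply: (@le_trans _ _ (A ^+ (2 * #|D'|) * B ^+ #|E| *
      \sum_(w : L.-tuple V) shape_mass v0 a rhon w * G w)).
    rewrite big_mkcond mulr_sumr; apply: ler_sum => w _.
    case: eqP => [wrho|_]; last by rewrite mulr_ge0 ?AB_ge0// mulr_ge0 ?mass0 ?G0.
    rewrite massE// le_eqVlt; apply/orP; left; apply/eqP.
    have -> : \prod_(t in D') row_sum a (tnth w t) =
        A ^+ (2 * #|D'|) * \prod_(t in D') s' (tnth w t).
      by under eq_bigr do rewrite sE; rewrite big_split/= prodr_const exprM.
    have -> : \prod_(t in E) beta (tnth w t) = B ^+ #|E| * \prod_(t in E) b' (tnth w t).
      by under eq_bigr do rewrite bE; rewrite big_split/= prodr_const.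
    by rewrite /G; ring.
  rewrite D1 mulnDr exprD -[leRHS]mulrA mulrC ler_wpM2r//.
(* For [p = 1] no factor is left and AM-GM would have exponent 0. *)
have [p1|p1] := posnP p.-1.
  have /eqP := E1; rewrite p1 addn_eq0 muln_eq0/= !cards_eq0 => /andP[/eqP D'0 /eqP E0].
  apply: (@le_trans _ _ (\sum_(w : L.-tuple V) shape_mass v0 a rhon w * (fun=> 1) (tnth w zero))).
    by apply: ler_sum => w _; rewrite /G D'0 E0 !big_set0 mulr1.
  apply: le_trans (marg (fun=> 1) zero _) _ => //.
  by move: sum_s_s'; rewrite p1; under eq_bigr do rewrite expr0.
apply: (@le_trans _ _ (\sum_(w : L.-tuple V) shape_mass v0 a rhon w *
   ((2 * \sum_(t in D') s' (tnth w t) ^+ p.-1 + \sum_(t in E) b' (tnth w t) ^+ (2 * p.-1))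
   / (2 * p.-1)%:R))).
  apply: ler_sum => w _; rewrite ler_wpM2l//; exact: prod_le_mean.
rewrite (eq_bigr (fun w : L.-tuple V =>
   (2 * (\sum_(t in D') shape_mass v0 a rhon w * s' (tnth w t) ^+ p.-1) +
    \sum_(t in E) shape_mass v0 a rhon w * b' (tnth w t) ^+ (2 * p.-1))
    / (2 * p.-1)%:R)); last first.
  by move=> w _; rewrite -!mulr_sumr; ring.
rewrite -mulr_suml ler_pdivrMr; last by rewrite ltr0n muln_gt0.
rewrite big_split/= -mulr_sumr exchange_big [X in _ + X]exchange_big/=.
rewrite -[in leRHS]E1 natrD mulrDr lerD//.
  rewrite natrM mulrCA ler_wpM2l// mulr_natr -sumr_const; apply: ler_sum => t _.
  apply: le_trans sum_s_s'; apply: (marg (fun i => s' i ^+ p.-1)) => i; exact: exprn_ge0.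
rewrite mulr_natr -sumr_const; apply: ler_sum => t _.
apply: le_trans sum_s_b'. apply: (marg (fun i => b' i ^+ (2 * p.-1))) => i; exact: exprn_ge0.
Qed.

End ShapeSum.

(** * Sums over all closed walks *)

(** The map [ordS] sends discoveries bijectively to the new times other than 0. *)
Lemma card_discoveries L (rho : L.-tuple 'I_L) : shape rho = rho ->
  #|discoveries rho| = #|new_times rho|.-1.
Proof.
case: L rho => [|L] rho rhoK; first by rewrite !eq_card0// => -[].
have n0 : ord0 \in new_times rho.
  rewrite inE; apply/eqP/val_inj/eqP; rewrite -leqn0 -[rho in leqLHS]rhoK.
  exact: (shape_le (s := ord0)).
rewrite (cardsD1 ord0 (new_times rho)) n0 -(card_imset (discoveries rho) (@ordS_inj L.+1)).
apply: eq_card => t; rewrite !inE; apply/imsetP/andP => [[u + ->]|[t0 tt]].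
  by rewrite inE lt0n -(inj_eq val_inj) => /andP[].
by exists (ord_pred t); rewrite ?inE ord_predK// lt0n -(inj_eq val_inj) in t0 *; apply/andP.
Qed.

(** If two discoveries share an edge, either they reach the same new vertex, hence at the same time,
    or each starts from the vertex the other discovers, so that each would precede the other. *)
Lemma discoveries_inj (V : finType) L (w : L.-tuple V) :
  {in discoveries (shape w) &, injective (walk_edge w)}.
Proof.
move=> s t; rewrite !inE => /andP[s0 /eqP ss] /andP[t0 /eqP tt] /eqP.
rewrite -walk_edge_shape /walk_edge eq_set2 ss tt.
have le u : (tnth (shape w) u <= u)%N by exact: shape_le.
case/orP => /andP[/eqP E1 /eqP E2].
  exact: ordS_inj.
have := le s; have := le t; rewrite E1 -E2 (ordS_pos s0) (ordS_pos t0) => h1 h2.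
by have := leq_trans h1 (ltnW h2); rewrite ltnn.
Qed.

Section Combine.
Variables (R : realType) (V : finType).
Variables (a b : V -> V -> R) (beta : V -> R).
Hypothesis a_ge0 : forall i j, 0 <= a i j.
Hypothesis a_sym : forall i j, a i j = a j i.
Hypothesis b_ge0 : forall i j, 0 <= b i j.
Hypothesis b_le : forall i j, b i j <= beta i.
Variables (A B : R) (p : nat).
Hypotheses (A_gt0 : 0 < A) (B_gt0 : 0 < B) (p_gt0 : (0 < p)%N).
Hypothesis sumA : \sum_i row_sum a i ^+ p <= A ^+ (2 * p).
Hypothesis sumB : \sum_i beta i ^+ (2 * p) <= B ^+ (2 * p).

Variable m : (2 * p).-tuple V -> R.
Hypothesis m_single : forall w, ~~ no_single_edge w -> m w <= 0.
Hypothesis m_le : forall w (D : {set 'I_(2 * p)}) (f : 'I_(2 * p) -> 'I_(2 * p)),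
  {in D &, injective (walk_edge w)} ->
  {in D, forall t, f t \notin D /\ walk_edge w (f t) = walk_edge w t} ->
  m w <= \prod_(t in D) a (tnth w t) (tnth w (ordS t)) *
         \prod_(t in ~: (D :|: f @: D)) b (tnth w t) (tnth w (ordS t)).

(** [m w] stands for the mean of the product of entries along [w]. With [k] discoveries,
    [sum_shape_le] bounds a shape by [B ^+ (2 * p) * x ^+ k], where [x = A ^+ 2 / B ^+ 2], and
    [sum_shapes_le] sums these bounds. *)
Lemma sum_walks_le :
  \sum_w m w <= (2 * A + 8 * Num.sqrt p%:R * B) ^+ (2 * p).
Proof.
pose L := (2 * p)%N.
have L0 : (0 < L)%N by rewrite muln_gt0.
pose good (rho : L.-tuple 'I_L) := (shape rho == rho) && no_single_edge rho.
have step1 (rho : L.-tuple 'I_L) : good rho ->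
    \sum_(w | shape w == rho) m w <=
    A ^+ (2 * #|discoveries rho|) * B ^+ (L - 2 * #|discoveries rho|) /\
    (2 * #|discoveries rho| <= L)%N.
  move=> /andP[/eqP rhoK nse]; set D := discoveries rho.
  (* Another visit of the same edge; it exists because [rho] has no single edge, so the default [t]
     is never taken. *)
  pose f t := odflt t [pick t' | (t' != t) && (walk_edge rho t' == walk_edge rho t)].
  have fP t : f t != t /\ walk_edge rho (f t) = walk_edge rho t.
    rewrite /f; case: pickP => [t' /andP[t't /eqP e]//|no].
    have /forallP/(_ t)/card_gt1P[x [y [+ +]]] := nse.
    rewrite !inE => xt yt; have := no x; have := no y; rewrite xt yt !andbT.
    by move=> /negbFE/eqP -> /negbFE/eqP ->; rewrite eqxx.
  have Dinj : {in D &, injective (walk_edge rho)}.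
    by have := @discoveries_inj _ _ rho; rewrite rhoK.
  have fD t : t \in D -> f t \notin D.
    move=> tD; apply/negP => ftD; have [/eqP+ e] := fP t; apply; exact: (Dinj _ _ ftD tD e).
  have f_inj : {in D &, injective f}.
    move=> s t sD tD e; apply: Dinj => //; have [_ <-] := fP s; have [_ <-] := fP t.
    by rewrite e.
  pose E := ~: (D :|: f @: D).
  have cardE : (#|E| + 2 * #|D| = L)%N.
    have dis : D :&: f @: D = set0.
      apply/setP => t; rewrite in_setI in_set0; apply/negP.
      by move=> /andP[tD /imsetP[s sD tE]]; have := fD s sD; rewrite -tE tD.
    have := cardsC (D :|: f @: D); rewrite card_ord cardsU dis cards0 subn0 card_in_imset//.
    by rewrite -/E addnn mul2n addnC.
  split; last by apply: leq_trans (eq_leq cardE); exact: leq_addl.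
  have -> : (L - 2 * #|D| = #|E|)%N 
    by apply/eqP; rewrite -(eqn_add2r (2 * #|D|)) cardE subnK // -[leqRHS]cardE leq_addl.
  apply: le_trans (sum_shape_le a_ge0 a_sym _ A_gt0 B_gt0 p_gt0 sumA sumB rhoK cardE); last first.
    by move=> i; apply: le_trans (b_le i i).
  apply: ler_sum => w /eqP wrho.
  have ew s t : walk_edge rho s = walk_edge rho t -> walk_edge w s = walk_edge w t.
    by move=> /eqP; rewrite -wrho walk_edge_shape => /eqP.
  apply: le_trans (m_le (w := w) (D := D) (f := f) _ _) _.
  - by rewrite /D -wrho; exact: discoveries_inj.
  - by move=> t tD; split; [exact: fD | apply: ew; exact: (fP t).2].
  apply: ler_wpM2l; first by apply: prodr_ge0.
  by apply: ler_prod => t _; rewrite b_ge0 b_le.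
have B2 : 0 < B ^+ 2 by rewrite exprn_gt0.
pose x := A ^+ 2 / B ^+ 2.
have x0 : 0 <= x by rewrite divr_ge0 ?sqr_ge0.
(* An integer between [x + L] and [x + L + 1]. *)
pose r := (Num.truncn x + L).+1.
have xr : x + L%:R <= r%:R.
  by rewrite /r -addSn natrD lerD2r ltW// truncnS_gt.
have rx : r%:R <= x + L%:R + 1.
  by rewrite /r -natr1 natrD lerD2r lerD2r truncn_le.
have sp0 : 0 < Num.sqrt p%:R :> R by rewrite sqrtr_gt0 ltr0n.
have sp2 : Num.sqrt p%:R ^+ 2 = p%:R :> R by rewrite sqr_sqrtr ?ler0n.
(* a' is chosen so that a' ^ 2 >= x + 9 p >= r + 2 L, and B (2 a' + b') is the  *)
(* bound of the lemma.                                                        *)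
pose a' := A / B + 3 * Num.sqrt p%:R; pose b' : R := 2 * Num.sqrt p%:R.
have a'0 : 0 < a' by rewrite addr_gt0 ?divr_gt0 ?mulr_gt0.
have b'0 : 0 < b' by rewrite mulr_gt0.
have p1 : 1 <= p%:R :> R by rewrite ler1n.
have ha : (r + 2 * L)%:R <= a' ^+ 2.
  have -> : a' ^+ 2 = x + 6 * (A / B) * Num.sqrt p%:R + 9 * Num.sqrt p%:R ^+ 2.
    by rewrite /a' /x; field; rewrite gt_eqF.
  rewrite sp2 natrD.
  have : 0 <= 6 * (A / B) * Num.sqrt p%:R by rewrite ltW// !mulr_gt0 ?invr_gt0.
  have : (2 * L)%:R = 4 * p%:R :> R by rewrite /L mulnA natrM.
  have : L%:R = 2 * p%:R :> R by rewrite /L natrM.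
  move: rx p1; lra.
have hb : (2 * L)%:R <= b' ^+ 2.
  by rewrite /b' exprMn sp2 /L mulnA natrM; lra.
have := sum_shapes_le L0 (ltn0Sn _ : (0 < r)%N) x0 a'0 b'0 xr ha hb.
rewrite -(ler_pM2l (exprn_gt0 L B_gt0)) -exprMn => H.
have BE : B * (2 * a' + b') = 2 * A + 8 * Num.sqrt p%:R * B.
  by rewrite /a' /b'; field; rewrite gt_eqF.
rewrite BE in H; apply: le_trans H.
rewrite (bigID (@no_single_edge V L))/= -[leRHS]addr0 lerD//; last first.
  by apply: sumr_le0 => w; exact: m_single.
rewrite (partition_big (@shape L V) good)/=; last first.
  by move=> w nw; rewrite /good shapeK eqxx no_single_edge_shape.
rewrite mulr_sumr; apply: ler_sum => rho grho.
have [H1 H2] := step1 rho grho.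
rewrite -card_discoveries; last by case/andP: grho => /eqP.
have -> : B ^+ L * x ^+ #|discoveries rho| =
   A ^+ (2 * #|discoveries rho|) * B ^+ (L - 2 * #|discoveries rho|).
  rewrite /x expr_div_n -!exprM -{1}(subnK H2) exprD; field.
  by rewrite expf_neq0// gt_eqF.
apply: le_trans H1; rewrite le_eqVlt; apply/orP; left; apply/eqP.
apply: eq_bigl => w; case: eqP => [wrho|]; last by rewrite andbF.
by rewrite -no_single_edge_shape wrho; case/andP: grho => _ ->.
Qed.

End Combine.

From mathcomp Require Import all_classical all_reals all_analysis.
From mathcomp Require Import measurable_realfun ess_sup_inf.

Import numFieldNormedType.Exports.

(** * Expectations of products of independent variables *)

Local Open Scope classical_set_scope.

Section BoundedMeasurable.
Context d (T : measurableType d) (R : realType).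
Implicit Types f g : T -> R.

(** The bound holds everywhere, so that products stay bounded and integrable. *)
Definition bdd_measurable f := measurable_fun setT f /\ exists M, forall x, `|f x| <= M.

Lemma bdd_measurable_cst (r : R) : bdd_measurable (fun=> r).
Proof. by split; [exact: measurable_cst|exists `|r|]. Qed.

Lemma bdd_measurableD f g : bdd_measurable f -> bdd_measurable g ->
  bdd_measurable (fun x => f x + g x).
Proof.
move=> [mf [M fM]] [mg [N gN]]; split; first exact: measurable_funD.
by exists (M + N) => x; rewrite (le_trans (ler_normD _ _))// lerD.
Qed.

Lemma bdd_measurableM f g : bdd_measurable f -> bdd_measurable g ->
  bdd_measurable (fun x => f x * g x).
Proof.
move=> [mf [M fM]] [mg [N gN]]; split; first exact: measurable_funM.
by exists (M * N) => x; rewrite normrM ler_pM.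
Qed.

Lemma bdd_measurable_sum (I : Type) (s : seq I) (F : I -> T -> R) (P : pred I) :
  (forall i, P i -> bdd_measurable (F i)) ->
  bdd_measurable (fun x => \sum_(i <- s | P i) F i x).
Proof.
move=> H; elim: s => [|i s IH].
  rewrite (_ : (fun _ => _) = fun=> 0); first exact: bdd_measurable_cst.
  by apply/funext => x; rewrite big_nil.
rewrite (_ : (fun _ => _) = fun x => if P i then F i x + \sum_(i <- s | P i) F i x
                                  else \sum_(i <- s | P i) F i x).
  by case: (boolP (P i)) => // Pi; apply: bdd_measurableD => //; exact: H.
by apply/funext => x; rewrite big_cons.
Qed.

Lemma bdd_measurable_prod (I : Type) (s : seq I) (F : I -> T -> R) (P : pred I) :
  (forall i, P i -> bdd_measurable (F i)) ->
  bdd_measurable (fun x => \prod_(i <- s | P i) F i x).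
Proof.
move=> H; elim: s => [|i s IH].
  rewrite (_ : (fun _ => _) = fun=> 1); first exact: bdd_measurable_cst.
  by apply/funext => x; rewrite big_nil.
rewrite (_ : (fun _ => _) = fun x => if P i then F i x * \prod_(i <- s | P i) F i x
                                  else \prod_(i <- s | P i) F i x).
  by case: (boolP (P i)) => // Pi; apply: bdd_measurableM => //; exact: H.
by apply/funext => x; rewrite big_cons.
Qed.

Lemma bdd_measurableX f n : bdd_measurable f -> bdd_measurable (fun x => f x ^+ n).
Proof.
move=> [mf [M fM]]; split; first exact: measurable_funX.
by exists (M ^+ n) => x; rewrite normrX lerXn2r// nnegrE// (le_trans _ (fM x)).
Qed.

Lemma bdd_measurable_norm f : bdd_measurable f -> bdd_measurable (fun x => `|f x|).
Proof.
move=> [mf [M fM]]; split; first exact: measurableT_comp.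
by exists M => x; rewrite normr_id.
Qed.

Lemma bdd_measurable_indic (A : set T) : measurable A -> bdd_measurable (\1_A : T -> R).
Proof.
move=> mA; split; first exact: measurable_indic.
by exists 1 => x; rewrite indicE; case: (_ \in _); rewrite ?normr1 ?normr0.
Qed.

(* Layer cake: the B k are superlevel sets of h. *)
Lemma bdd_measurable_approx (h : T -> R) (e : R) : bdd_measurable h -> 0 < e ->
  exists (n : nat) (c : R) (B : nat -> set T), (forall k, measurable (B k)) /\
    forall x, `|h x - (c + \sum_(k < n) e * \1_(B k) x)| <= e.
Proof.
move=> [mh [M hM]] e0.
pose y x := h x + M; pose n := (Num.truncn (2 * M / e)).+1.
pose B (k : nat) := [set x | k.+1%:R * e <= y x].
exists n, (- M), B; split.
  move=> k.
  have my : measurable_fun setT y by apply: measurable_funD.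
  rewrite (_ : B k = setT `&` y @^-1` `[k.+1%:R * e, +oo[).
    by apply: my => //; exact: measurable_itv.
  by rewrite setTI; apply/seteqP; split => x /=; rewrite in_itv/= andbT.
move=> x.
have y0 : 0 <= y x by have := hM x; rewrite ler_norml => /andP[]; rewrite /y; lra.
have yM : y x <= n%:R * e.
  rewrite -ler_pdivrMr//; apply: le_trans (_ : 2 * M / e <= _).
    rewrite ler_pM2r ?invr_gt0//.
    by have := hM x; rewrite ler_norml => /andP[]; rewrite /y; lra.
  exact/ltW/truncnS_gt.
(* The first [m] levels are saturated if [y x] reaches the last of them; otherwise their sum rounds
   [y x] down with error at most [e]. *)
have key m : (m%:R * e <= y x -> \sum_(k < m) e * \1_(B k) x = m%:R * e) /\
   (y x <= m%:R * e -> \sum_(k < m) e * \1_(B k) x <= y x <= \sum_(k < m) e * \1_(B k) x + e).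
  elim: m => [|m [IH1 IH2]].
    by rewrite big_ord0 mul0r; split=> // ?; rewrite y0 add0r; lra.
  rewrite big_ord_recr/= indicE.
  have [h1|h1] := leP (m.+1%:R * e) (y x).
    rewrite mem_set//= mulr1 IH1; last first.
      by apply: le_trans h1; rewrite ler_pM2r// ler_nat.
    rewrite -natr1 mulrDl mul1r; split=> // h2.
    by rewrite -natr1 mulrDl mul1r in h1; apply/andP; split; lra.
  rewrite memNset//=; last by rewrite /B/=; apply/negP; rewrite -ltNge.
  rewrite mulr0 addr0; split=> [//|_].
  have /orP[h2|h2] := le_total (y x) (m%:R * e); first exact: IH2.
  by rewrite (IH1 h2) h2/= ltW//; move: h1; rewrite -natr1 mulrDl mul1r.
have /andP[k1 k2] := (key n).2 yM.
rewrite ler_norml; apply/andP; move: k1 k2; rewrite /y; set s := \sum_(_ < _) _.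
by move=> k1 k2; split; lra.
Qed.

(** Step functions are uniformly dense and [Phi] is continuous for the sup norm. This extends
    independence from events to bounded functions. *)
Lemma bdd_measurable_ext (Phi : (T -> R) -> R) (C : R) :
  (forall f g, bdd_measurable f -> bdd_measurable g ->
     Phi (fun x => f x + g x) = Phi f + Phi g) ->
  (forall r f, bdd_measurable f -> Phi (fun x => r * f x) = r * Phi f) ->
  (forall f e, bdd_measurable f -> (forall x, `|f x| <= e) -> `|Phi f| <= C * e) ->
  (forall A, measurable A -> Phi (\1_A) = 0) ->
  forall f, bdd_measurable f -> Phi f = 0.
Proof.
move=> PhiD PhiZ PhiB Phi1 h bh.
have C0 : 0 <= C.
  have := PhiB (fun=> 0) 1 (bdd_measurable_cst 0); rewrite normr0 ler01 mulr1.
  by move=> /(_ (fun=> isT)) /(le_trans (normr_ge0 _)).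
apply/eqP; rewrite -normr_le0; apply/ler_addgt0Pr => e e0; rewrite add0r.
pose e' := e / (C + 1).
have C1 : 0 < C + 1 by rewrite ltr_wpDl.
have e'0 : 0 < e' by rewrite divr_gt0.
have [n [c [B [mB hB]]]] := bdd_measurable_approx bh e'0.
have Phisum m : Phi (fun x => \sum_(k < m) e' * \1_(B k) x) = 0.
  elim: m => [|m IH].
    rewrite -[RHS](mul0r (Phi (fun=> 0))) -PhiZ; last exact: bdd_measurable_cst.
    by congr Phi; apply/funext => x; rewrite big_ord0 mul0r.
  under eq_fun do rewrite big_ord_recr/=.
  rewrite PhiD.
  - by rewrite IH add0r PhiZ ?Phi1 ?mulr0//; exact: bdd_measurable_indic.
  - apply: bdd_measurable_sum => i _; apply: bdd_measurableM; first exact: bdd_measurable_cst.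
    exact: bdd_measurable_indic.
  - apply: bdd_measurableM; first exact: bdd_measurable_cst.
    exact: bdd_measurable_indic.
have Phic : Phi (fun=> c) = 0.
  rewrite -(mulr0 c) -(Phi1 setT)// -PhiZ; last exact: bdd_measurable_indic.
  by congr Phi; apply/funext => x; rewrite indicT/= mulr1.
pose s x := c + \sum_(k < n) e' * \1_(B k) x.
have bs' : bdd_measurable (fun x => \sum_(k < n) e' * \1_(B k) x).
  apply: bdd_measurable_sum => i _; apply: bdd_measurableM; first exact: bdd_measurable_cst.
  exact: bdd_measurable_indic.
have bs : bdd_measurable s by apply: bdd_measurableD => //; exact: bdd_measurable_cst.
have Ns : bdd_measurable (fun x => -1 * s x).
  by apply: bdd_measurableM => //; exact: bdd_measurable_cst.
have Phis : Phi s = 0 by rewrite /s PhiD// ?Phic ?Phisum ?addr0//; exact: bdd_measurable_cst.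
have : `|Phi (fun x => h x + -1 * s x)| <= C * e'.
  by apply: PhiB => [|x]; [exact: bdd_measurableD|rewrite mulN1r; exact: hB].
rewrite PhiD// PhiZ// Phis mulr0 addr0 => /le_trans; apply.
rewrite /e' mulrA ler_pdivrMr// mulrC ler_pM2l//; lra.
Qed.

End BoundedMeasurable.

Section Expectation.
Context d (T : measurableType d) (R : realType) (P : probability T R).
Implicit Types f g : T -> R.

Notation Ex f := (Rintegral P setT f).

Lemma bdd_measurable_integrable f : bdd_measurable f -> P.-integrable setT (EFin \o f).
Proof.
move=> [mf [M fM]]; apply: measurable_bounded_integrable => //.
  by rewrite -ge0_fin_numE ?fin_num_measure.
by exists M; split; [exact: num_real|move=> x Mx y _ /=; exact: le_trans (fM y) (ltW Mx)].
Qed.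

Lemma ExD f g : bdd_measurable f -> bdd_measurable g ->
  Ex (fun x => f x + g x) = Ex f + Ex g.
Proof. by move=> bf bg; apply: RintegralD => //; exact: bdd_measurable_integrable. Qed.

Lemma ExZ r f : bdd_measurable f -> Ex (fun x => r * f x) = r * Ex f.
Proof. by move=> bf; apply: RintegralZl => //; exact: bdd_measurable_integrable. Qed.

Lemma Ex_cst r : Ex (fun=> r) = r.
Proof.
rewrite Rintegral_cst// -[RHS]mulr1; congr (_ * _).
by rewrite -[RHS]/(fine 1%E); congr fine; exact: probability_setT.
Qed.

Lemma le_Ex f g : bdd_measurable f -> bdd_measurable g -> (forall x, f x <= g x) ->
  Ex f <= Ex g.
Proof. by move=> bf bg fg; apply: le_Rintegral => //; exact: bdd_measurable_integrable. Qed.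

Lemma Ex_norm_le f e : bdd_measurable f -> (forall x, `|f x| <= e) -> `|Ex f| <= e.
Proof.
move=> bf fe; apply: le_trans (le_normr_Rintegral _ (bdd_measurable_integrable bf)) _ => //.
by rewrite -[leRHS]Ex_cst le_Ex//; [exact: bdd_measurable_norm|exact: bdd_measurable_cst].
Qed.

Lemma Ex_sum (I : Type) (s : seq I) (F : I -> T -> R) :
  (forall i, bdd_measurable (F i)) ->
  Ex (fun x => \sum_(i <- s) F i x) = \sum_(i <- s) Ex (F i).
Proof.
move=> H; elim: s => [|i s IH].
  by under eq_fun do rewrite big_nil; rewrite Ex_cst big_nil.
under eq_fun do rewrite big_cons.
by rewrite ExD ?IH ?big_cons//; exact: bdd_measurable_sum.
Qed.

Lemma Ex_indic (A : set T) : measurable A -> Ex (\1_A) = fine (P A).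
Proof. by move=> mA; rewrite /Rintegral integral_indic// setIT. Qed.

Lemma EFin_Ex f : bdd_measurable f -> (Ex f)%:E = 'E_P[f]%E.
Proof.
move=> bf; rewrite unlock fineK//; apply: integrable_fin_num => //.
exact: bdd_measurable_integrable.
Qed.

Lemma bdd_measurable_comp (h : R -> R) (X : {RV P >-> R}) :
  bdd_measurable h -> bdd_measurable (fun w => h (X w)).
Proof.
move=> [mh [M hM]]; split; last by exists M.
exact: (measurableT_comp mh).
Qed.

(** Starting from indicators, where the claim is independence itself, the factors are made general
    one at a time. *)
Lemma independent_Ex_prod (I : finType) (D : {set I}) (X : I -> {RV P >-> R}) :
  independent_RVs D X ->
  forall (J : {set I}) (g : I -> R -> R), J \subset D ->
    (forall i, bdd_measurable (g i)) ->
    Ex (fun w => \prod_(i in J) g i (X i w)) = \prod_(i in J) Ex (fun w => g i (X i w)).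
Proof.
move=> indep J g JD bg.
have bgX (h : I -> R -> R) : (forall i, bdd_measurable (h i)) ->
    forall i, bdd_measurable (fun w => h i (X i w)).
  by move=> bh i; exact: bdd_measurable_comp.
(* [s] lists the indices that may carry a general function; the indices of [J] outside [s] carry
   indicators. *)
suff H (s : seq I) (h : I -> R -> R) : (forall i, bdd_measurable (h i)) ->
    (forall i, i \in J -> i \notin s -> exists2 B, measurable B & h i = \1_B) ->
    Ex (fun w => \prod_(i in J) h i (X i w)) = \prod_(i in J) Ex (fun w => h i (X i w)).
  by apply: (H (enum J)) => // i iJ; rewrite mem_enum iJ.
elim: s h => [|i0 s IH] h bh hs.
  have /choice[B hB] : forall i, exists B, i \in J -> measurable B /\ h i = \1_B.
    move=> i; have [iJ|] := boolP (i \in J); last by exists set0.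
    by have [B mB hB] := hs i iJ isT; exists B.
  have -> : (fun w => \prod_(i in J) h i (X i w)) = \1_(\bigcap_(i in [set` J]) (X i @^-1` B i)).
    apply/funext => w; rewrite indicE.
    have [/set_mem wB|wB] := boolP (w \in _).
      rewrite big1// => i iJ; have [_ ->] := hB i iJ.
      by rewrite indicE mem_set//; exact: wB.
    apply/eqP/prodf_eq0; move: wB => /negP; rewrite inE => /existsNP[i /not_implyP[iJ nB]].
    by exists i => //; have [_ ->] := hB i iJ; rewrite indicE memNset.
  have mX i : i \in J -> measurable (X i @^-1` B i).
    by move=> iJ; rewrite -[_ @^-1` _]setTI; apply: (measurable_funPT (X i)) => //;
      exact: (hB i iJ).1.
  rewrite Ex_indic; last by apply: fin_bigcap_measurable => // i /= iJ; exact: mX.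
  rewrite indep//; last by move=> i iJ; exact: (hB i iJ).1.
  rewrite (_ : (\prod_(i in J) P (X i @^-1` B i))%E =
     (\prod_(i in J) fine (P (X i @^-1` B i)))%:E).
    rewrite /=; apply: eq_bigr => i iJ; have [mB ->] := hB i iJ.
    rewrite -Ex_indic; last exact: mX.
    by congr (Rintegral _ _ _); apply/funext => w; rewrite !indicE.
  rewrite -prodEFin; apply: eq_bigr => i iJ; rewrite fineK//.
  by apply: fin_num_measure; exact: mX.
have [i0J|i0J] := boolP (i0 \in J); last first.
  apply: IH => // i iJ is_; apply: hs => //; rewrite inE negb_or is_ andbT.
  by apply: contraNneq i0J => <-.
pose Z w := \prod_(i in J :\ i0) h i (X i w).
pose c := \prod_(i in J :\ i0) Ex (fun w => h i (X i w)).
have bZ : bdd_measurable Z by apply: bdd_measurable_prod => i _; exact: bgX.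
have [_ [M ZM]] := bZ.
(* The difference of the two sides as a linear functional of the factor at [i0]; on indicators the
   induction hypothesis applies. *)
pose Phi (f : R -> R) := Ex (fun w => f (X i0 w) * Z w) - Ex (fun w => f (X i0 w)) * c.
have bfX (f : R -> R) : bdd_measurable f -> bdd_measurable (fun w => f (X i0 w)).
  exact: bdd_measurable_comp.
have bfZ (f : R -> R) : bdd_measurable f -> bdd_measurable (fun w => f (X i0 w) * Z w).
  by move=> bf; apply: bdd_measurableM => //; exact: bfX.
suff /eqP : Phi (h i0) = 0.
  rewrite subr_eq0 => /eqP.
  rewrite (big_setD1 i0 i0J)/= -/c => <-; congr (Rintegral _ _ _); apply/funext => w.
  by rewrite (big_setD1 i0 i0J).
apply: (@bdd_measurable_ext _ _ _ Phi (M + `|c|)) => //.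
- move=> f k bf bk; rewrite /Phi.
  under eq_fun do rewrite mulrDl.
  by rewrite (ExD (bfZ f bf) (bfZ k bk)) (ExD (bfX f bf) (bfX k bk)); ring.
- move=> r f bf; rewrite /Phi; under eq_fun do rewrite -mulrA.
  by rewrite (ExZ r (bfZ f bf)) (ExZ r (bfX f bf)); ring.
- move=> f e bf fe; apply: le_trans (ler_normB _ _) _; rewrite mulrDl lerD//.
    apply: Ex_norm_le; first exact: bfZ.
    by move=> w; rewrite normrM mulrC ler_pM.
  rewrite normrM mulrC ler_wpM2l//; apply: Ex_norm_le; first exact: bfX.
  by move=> w.
move=> A mA.
pose h' i := if i == i0 then (\1_A : R -> R) else h i.
have bh' i : bdd_measurable (h' i).
  by rewrite /h'; case: ifP => // _; exact: bdd_measurable_indic.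
have := IH h' bh'; rewrite !(big_setD1 i0 i0J)/=.
have -> : \prod_(i in J :\ i0) Ex (fun w => h' i (X i w)) = c.
  by apply: eq_bigr => i; rewrite !inE /h' => /andP[/negbTE ->].
have -> : (fun w => \prod_(i in J) h' i (X i w)) = (fun w => \1_A (X i0 w) * Z w).
  apply/funext => w; rewrite (big_setD1 i0 i0J)/= {1}/h' eqxx; congr (_ * _).
  by apply: eq_bigr => i; rewrite !inE /h' => /andP[/negbTE ->].
rewrite /h' eqxx => /(_ _)/eqP; rewrite -subr_eq0 => H; apply/eqP; apply: H => i iJ is_.
case: eqP => [_|/eqP ii0]; first by exists A.
by apply: hs => //; rewrite inE negb_or ii0.
Qed.

End Expectation.

Local Close Scope classical_set_scope.

(** * Traces of powers *)

Lemma mxE_exp (R : comNzRingType) n (S : 'M[R]_n) l i k (d : 'I_n) :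
  (S ^+ l.+1) i k =
  \sum_(q : l.-tuple 'I_n) \prod_(t < l.+1) S (nth d (i :: q) t) (nth d (rcons q k) t).
Proof.
elim: l i => [|l IH] i.
  rewrite (big_tuple0 (fun q => \prod_(t < 1) S (nth d (i :: q) t) (nth d (rcons q k) t))).
  by rewrite big_ord_recl big_ord0 mulr1.
rewrite exprS -mulmxE mxE.
rewrite (big_tuple_cons _ (fun q => \prod_(t < l.+2) S (nth d (i :: q) t) (nth d (rcons q k) t))).
apply: eq_bigr => j _; rewrite IH mulr_sumr; apply: eq_bigr => q _.
by rewrite [RHS]big_ord_recl.
Qed.

Lemma mxtrace_exp (R : comNzRingType) n (S : 'M[R]_n) L : (0 < L)%N ->
  \tr (S ^+ L) = \sum_(w : L.-tuple 'I_n) \prod_t S (tnth w t) (tnth w (ordS t)).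
Proof.
case: L => // l _.
rewrite big_tuple_thead.
apply: eq_bigr => i _; rewrite (mxE_exp _ _ _ _ i); apply: eq_bigr => q _.
by apply: eq_bigr => t _; rewrite (tnth_cons_ordS i i) (tnth_nth i).
Qed.

Lemma mxtrace_sqr_ge0 (R : realType) n (S : 'M[R]_n) : S^T = S -> 0 <= \tr (S *m S).
Proof.
move=> ST; rewrite -{2}ST; apply: sumr_ge0 => i _; rewrite mxE.
by apply: sumr_ge0 => j _; rewrite mxE -expr2 sqr_ge0.
Qed.

Lemma trmx_exp (R : comNzRingType) n (S : 'M[R]_n) k : S^T = S -> (S ^+ k)^T = S ^+ k.
Proof.
move=> ST; elim: k => [|k IH]; first by rewrite !expr0 -idmxE trmx1.
by rewrite {1}exprSr -mulmxE trmx_mul IH ST mulmxE -exprS.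
Qed.

(** An even power of [mxabs S] is a power of [S *m S], and its trace is nonnegative, so the root can
    be undone. *)
Lemma schatten_norm_exp (R : realType) n (S : 'M[R]_n) p : (0 < p)%N -> S^T = S ->
  schatten_norm (2 * p) S ^+ (2 * p) = \tr (S ^+ (2 * p)).
Proof.
move=> p0 ST; rewrite /schatten_norm.
have -> : mxabs S ^+ (2 * p) = S ^+ (2 * p).
  by rewrite !exprM !expr2 -!mulmxE (mxabsP S).2 ST.
rewrite -powR_mulrn ?powR_ge0// -powRrM mulVf ?powRr1//.
  by rewrite mul2n -addnn exprD -mulmxE mxtrace_sqr_ge0// trmx_exp.
by rewrite pnatr_eq0 muln_eq0/= -lt0n.
Qed.

(** * Random matrices *)

Section Clip.
Variable R : realType.

(** Truncation makes an almost sure bound hold everywhere and acts on each entry separately, which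
    preserves independence. *)
Definition clip (c x : R) := Num.max (- c) (Num.min x c).

Lemma norm_clip c x : 0 <= c -> `|clip c x| <= c.
Proof.
move=> c0; rewrite ler_norml /clip le_max lexx/= ge_max ge_min lexx orbT andbT.
by rewrite (le_trans _ c0)// oppr_le0.
Qed.

Lemma clip_id c x : `|x| <= c -> clip c x = x.
Proof.
by rewrite ler_norml /clip => /andP[h1 h2]; rewrite (min_idPl h2) (max_idPr h1).
Qed.

Lemma bdd_measurable_clip c : 0 <= c -> bdd_measurable (clip c).
Proof.
move=> c0; split; last by exists c => x; exact: norm_clip.
by apply: measurable_maxr => //; exact: measurable_minr.
Qed.

End Clip.

(** * Means of walks in the clipped matrix *)

Section Walks.
Context d (T : measurableType d) (R : realType) (P : probability T R).
Notation Ex f := (Rintegral P setT f).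

Lemma expectation_ae_eq (f g : T -> R) : measurable_fun setT f -> bdd_measurable g ->
  {ae P, forall w, f w = g w} -> ('E_P[f] = (Ex g)%:E)%E.
Proof.
move=> mf bg fg; rewrite EFin_Ex// unlock; apply: ae_eq_integral => //.
- exact/measurable_EFinP.
- by apply/measurable_EFinP; exact: bg.1.
- by apply: filterS fg => w -> _.
Qed.

Variables (n : nat) (X : 'I_n -> 'I_n -> {RV P >-> R}).
Hypothesis X_sym : forall i j w, X i j w = X j i w.
Hypothesis X_indep : independent_RVs (lower_triangle n)
  (fun ij : 'I_n * 'I_n => X ij.1 ij.2).
Variable b : 'I_n -> 'I_n -> R.
Hypothesis b_ge0 : forall i j, 0 <= b i j.
Hypothesis b_sym : forall i j, b i j = b j i.

(* X i j agrees almost surely with this bounded variable when b i j is its    *)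
(* essential supremum.                                                        *)
Definition clipped i j (w : T) := clip (b i j) (X i j w).
Notation Y := clipped.
Hypothesis Y_centered : forall i j, Ex (Y i j) = 0.

Let a i j := Ex (fun w => Y i j w ^+ 2).

Lemma clipped_sym i j : Y i j = Y j i.
Proof. by apply/funext => w; rewrite /clipped b_sym X_sym. Qed.

Lemma bdd_measurable_clipped i j : bdd_measurable (Y i j).
Proof. by apply: bdd_measurable_comp; exact: bdd_measurable_clip. Qed.

Lemma norm_clipped i j w : `|Y i j w| <= b i j.
Proof. exact: norm_clip. Qed.

(** The representative of an unordered pair of indices among the independent entries. *)
Definition lower_pair (i j : 'I_n) := if (j <= i)%N then (i, j) else (j, i).

Lemma lower_pairP i j : lower_pair i j \in lower_triangle n.
Proof.
by rewrite /lower_pair inE; case: (leqP j i) => //= /ltnW.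
Qed.

Lemma clipped_lower i j : Y (lower_pair i j).1 (lower_pair i j).2 = Y i j.
Proof. by rewrite /lower_pair; case: ifP => // _; exact: clipped_sym. Qed.

Lemma lower_pair_eq i j k l : (lower_pair i j == lower_pair k l) = ([set i; j] == [set k; l]).
Proof.
rewrite eq_set2 /lower_pair.
by case: (leqP j i) => ji; case: (leqP l k) => lk;
  rewrite xpair_eqE -!(inj_eq val_inj)/=; clear -ji lk; lia.
Qed.

Section FixedLength.
Variable L : nat.
Implicit Types w : L.-tuple 'I_n.

Let step w t := lower_pair (tnth w t) (tnth w (ordS t)).

Definition walk_mean w := Ex (fun x => \prod_t Y (tnth w t) (tnth w (ordS t)) x).

Let step_eq w s t : (step w s == step w t) = (walk_edge w s == walk_edge w t).
Proof. exact: lower_pair_eq. Qed.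

Lemma Ex_prod_clipped (J : {set 'I_n * 'I_n}) (k : 'I_n * 'I_n -> nat) :
  J \subset lower_triangle n ->
  Ex (fun x => \prod_(e in J) Y e.1 e.2 x ^+ k e) =
  \prod_(e in J) Ex (fun x => Y e.1 e.2 x ^+ k e).
Proof.
move=> JD.
apply: (independent_Ex_prod X_indep JD (g := fun e x => clip (b e.1 e.2) x ^+ k e)).
by move=> e; apply: bdd_measurableX; exact: bdd_measurable_clip.
Qed.

(** Grouping equal entries, the mean factors by independence, and the entry visited once has mean
    0. *)
Lemma walk_mean_single w : ~~ no_single_edge w -> walk_mean w = 0.
Proof.
move=> /forallPn[t0]; rewrite -leqNgt => t0_le1.
have t0_single : #|[set t | step w t == step w t0]| = 1%N.
  apply/eqP; rewrite eqn_leq; apply/andP; split.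
    by apply: leq_trans t0_le1; apply/subset_leq_card/fintype.subsetP => t; rewrite !inE step_eq.
  by apply/card_gt0P; exists t0; rewrite inE.
pose k e := #|[set t | step w t == e]|.
have -> : walk_mean w = Ex (fun x => \prod_(e in lower_triangle n) Y e.1 e.2 x ^+ k e).
  congr (Rintegral _ _ _); apply/funext => x.
  rewrite (partition_big (step w) (mem (lower_triangle n)))/=; last first.
    by move=> t _; exact: lower_pairP.
  apply: eq_bigr => e _; rewrite /k -prodr_const.
  apply: eq_big => t; first by rewrite inE.
  by move=> /eqP <-; rewrite clipped_lower.
rewrite Ex_prod_clipped// (big_setD1 (step w t0))/=; last exact: lower_pairP.
by rewrite /k t0_single clipped_lower Y_centered mul0r.
Qed.

(** The entries at [t] and [f t] are merged into a square and those outside [D] and its image are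
    bounded by [b]. The squares belong to distinct entries, so their mean is a product of
    variances. *)
Lemma walk_mean_le w (D : {set 'I_L}) (f : 'I_L -> 'I_L) :
  {in D &, injective (walk_edge w)} ->
  {in D, forall t, f t \notin D /\ walk_edge w (f t) = walk_edge w t} ->
  walk_mean w <= \prod_(t in D) a (tnth w t) (tnth w (ordS t)) *
     \prod_(t in ~: (D :|: f @: D)) b (tnth w t) (tnth w (ordS t)).
Proof.
move=> Dinj Df.
pose y t x := Y (tnth w t) (tnth w (ordS t)) x.
set E := ~: _.
have f_inj : {in D &, injective f}.
  by move=> s t sD tD e; apply: Dinj => //; rewrite -(Df s sD).2 -(Df t tD).2 e.
have by_ t : bdd_measurable (y t) by exact: bdd_measurable_clipped.
have yf x t : t \in D -> y (f t) x = y t x.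
  move=> tD; have /eqP := (Df t tD).2; rewrite -step_eq => /eqP e.
  by rewrite /y -clipped_lower -/(step w (f t)) e clipped_lower.
have prodE x : \prod_t `|y t x| = \prod_(t in D) y t x ^+ 2 * \prod_(t in E) `|y t x|.
  rewrite (bigID (mem (D :|: f @: D)))/=; congr (_ * _); last first.
    by apply: eq_bigl => t; rewrite [in RHS]inE.
  have dis : [disjoint D & f @: D].
    rewrite -setI_eq0; apply/eqP/setP => t; rewrite !inE; apply/negP.
    by move=> /andP[tD /imsetP[s sD tE]]; have := (Df s sD).1; rewrite -tE tD.
  under eq_bigl do rewrite finset.in_setU.
  rewrite (bigU _ _ _ dis)/= (big_imset _ f_inj)/= -big_split/=.
  by apply: eq_bigr => t tD; rewrite yf// -expr2 real_normK ?num_real.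
apply: (@le_trans _ _ (Ex (fun x => (\prod_(t in E) b (tnth w t) (tnth w (ordS t))) *
    \prod_(t in D) y t x ^+ 2))).
  apply: le_Ex.
  - by apply: bdd_measurable_prod => t _; exact: by_.
  - apply: bdd_measurableM; first exact: bdd_measurable_cst.
    by apply: bdd_measurable_prod => t _; apply: bdd_measurableX; exact: by_.
  move=> x; apply: le_trans (ler_norm _) _; rewrite normr_prod prodE mulrC.
  apply: ler_wpM2r; first by apply: prodr_ge0 => t _; exact: sqr_ge0.
  by apply: ler_prod => t _; rewrite normr_ge0 norm_clipped.
rewrite ExZ; last first.
  by apply: bdd_measurable_prod => t _; apply: bdd_measurableX; exact: by_.
rewrite mulrC le_eqVlt; apply/orP; left; apply/eqP; congr (_ * _).
have sinj : {in D &, injective (step w)}.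
  by move=> s t sD tD /eqP; rewrite step_eq => /eqP; exact: Dinj.
have JD : step w @: D \subset lower_triangle n.
  by apply/fintype.subsetP => e /imsetP[t _ ->]; exact: lower_pairP.
have := Ex_prod_clipped (fun=> 2%N) JD.
rewrite (big_imset _ sinj)/= => H.
under [RHS]eq_bigr do rewrite /a -clipped_lower.
rewrite -H; congr (Rintegral _ _ _); apply/funext => x.
by rewrite (big_imset _ sinj)/=; apply: eq_bigr => t _; rewrite /y -clipped_lower.
Qed.

End FixedLength.

Variables (A B : R) (p : nat).
Hypotheses (A_gt0 : 0 < A) (B_gt0 : 0 < B) (p_gt0 : (0 < p)%N).
Hypothesis sumA : \sum_i (\sum_j a i j) ^+ p <= A ^+ (2 * p).
Hypothesis sumB : \sum_i \sum_j b i j ^+ (2 * p) <= B ^+ (2 * p).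

Lemma sum_walk_mean_le : \sum_(w : (2 * p).-tuple 'I_n) walk_mean w <=
  (2 * A + 8 * Num.sqrt p%:R * B) ^+ (2 * p).
Proof.
(* The norm of row [i] in exponent [2 * p]: it dominates each [b i j], and its powers sum to the
   double sum in [sumB]. *)
pose beta i := (\sum_j b i j ^+ (2 * p)) `^ (2 * p)%:R^-1.
have p2 : (2 * p)%:R != 0 :> R by rewrite pnatr_eq0 muln_eq0/= -lt0n.
have sum0 i : 0 <= \sum_j b i j ^+ (2 * p) by apply: sumr_ge0 => j _; exact: exprn_ge0.
have betaX i : beta i ^+ (2 * p) = \sum_j b i j ^+ (2 * p).
  by rewrite /beta -powR_mulrn ?powR_ge0// -powRrM mulVf// powRr1.
apply: (@sum_walks_le _ _ a b beta) => //.
- move=> i j; apply: Rintegral_ge0 => x _; exact: sqr_ge0.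
- by move=> i j; rewrite /a clipped_sym.
- move=> i j; rewrite -(@ler_pXn2r _ (2 * p)) ?nnegrE ?powR_ge0 ?muln_gt0//.
  rewrite betaX (bigD1 j)//= lerDl; apply: sumr_ge0 => k _; exact: exprn_ge0.
- by under eq_bigr do rewrite betaX.
- by move=> w /walk_mean_single ->.
- exact: walk_mean_le.
Qed.

End Walks.

(** * From the moment bound to the norm inequality *)

Local Open Scope classical_set_scope.

Lemma Lnorm_infty_bound d (T : measurableType d) (R : realType) (P : probability T R)
    (X : {RV P >-> R}) :
  (exists M : R, {ae P, forall w, `|X w| <= M}) ->
  exists c : R, [/\ 0 <= c, Lnorm P +oo%E (fun w => (X w)%:E) = c%:E &
                    {ae P, forall w, `|X w| <= c}].
Proof.
move=> [M XM].
have P0 : (0 < P [set: T])%E by rewrite [P _]probability_setT.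
set N := Lnorm P +oo%E _.
have NE : N = ess_sup P (abse \o (fun w => (X w)%:E)) by rewrite /N unlock P0.
have N0 : (0 <= N)%E by exact: Lnorm_ge0.
have NM : (N <= M%:E)%E.
  by rewrite NE; apply/ess_supP; apply: filterS XM => w; rewrite /= lee_fin.
have Nfin : N \is a fin_num.
  by rewrite ge0_fin_numE// (le_lt_trans NM)// ltry.
exists (fine N); split; [exact: fine_ge0|by rewrite fineK|].
have := ess_sup_ge P (abse \o (fun w => (X w)%:E)); rewrite -NE.
by apply: filterS => w /=; rewrite -{1}(fineK Nfin) lee_fin.
Qed.

(** The roots of [y] and [z] may vanish, whereas [A] and [B] are positive; both roots are enlarged
    slightly and the total error [e] is arbitrary. *)
Lemma le_add_powR (R : realType) (x y z C : R) (q : nat) : (0 < q)%N ->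
  0 <= x -> 0 <= y -> 0 <= z -> 0 <= C ->
  (forall A B, 0 < A -> 0 < B -> y <= A ^+ q -> z <= B ^+ q ->
     x <= (2 * A + C * B) ^+ q) ->
  x `^ q%:R^-1 <= 2 * y `^ q%:R^-1 + C * z `^ q%:R^-1.
Proof.
move=> q0 x0 y0 z0 C0 H.
have qn : q%:R != 0 :> R by rewrite pnatr_eq0 -lt0n.
have rootK (u : R) : 0 <= u -> (u `^ q%:R^-1) ^+ q = u.
  by move=> u0; rewrite -powR_mulrn ?powR_ge0// -powRrM mulVf// powRr1.
apply/ler_addgt0Pr => e e0.
pose e' := e / (2 + C).
have C2 : 0 < 2 + C by rewrite ltr_pwDl.
have e'0 : 0 < e' by rewrite divr_gt0.
have le_root (u : R) : 0 <= u -> u <= (u `^ q%:R^-1 + e') ^+ q.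
  by move=> u0; rewrite -[leLHS](rootK u)// lerXn2r ?nnegrE ?addr_ge0 ?powR_ge0 ?lerDl// ltW.
have := H (y `^ q%:R^-1 + e') (z `^ q%:R^-1 + e').
rewrite !ltr_wpDl ?powR_ge0// => /(_ isT isT (le_root y y0) (le_root z z0)) {}H.
have : x `^ q%:R^-1 <= 2 * (y `^ q%:R^-1 + e') + C * (z `^ q%:R^-1 + e').
  rewrite -(@ler_pXn2r _ q) ?nnegrE ?powR_ge0 ?rootK//.
  by rewrite addr_ge0// mulr_ge0// addr_ge0 ?powR_ge0// ltW.
move=> /le_trans; apply; rewrite le_eqVlt; apply/orP; left; apply/eqP.
have : (2 + C) * e' = e by rewrite /e' mulrC divfK// gt_eqF.
lra.
Qed.

Local Open Scope ereal_scope.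

Theorem theorem1p5 (R : realType) :
  exists C : R,
    forall (d : measure_display) (T : measurableType d) (P : probability T R)
      (n : nat) (X : 'I_n -> 'I_n -> {RV P >-> R}),
      (forall w : T, ((random_matrix X w)^T)%R = random_matrix X w) ->
      independent_RVs (lower_triangle n)
        (fun ij : 'I_n * 'I_n => X ij.1 ij.2) ->
      (forall i j : 'I_n, 'E_P[X i j] = 0) ->
      (exists M : R, forall i j : 'I_n, {ae P, forall w, (`|X i j w| <= M)%R}) ->
      forall p : nat, (0 < p)%N ->
        'E_P[fun w => (schatten_norm (2 * p) (random_matrix X w) ^+ (2 * p))%R]
          `^ ((2 * p)%:R^-1)
        <= 2%:E *
             (\sum_(i < n) (\sum_(j < n) 'E_P[fun w => (X i j w ^+ 2)%R]) ^+ p)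
               `^ ((2 * p)%:R^-1)
           + (C * Num.sqrt p%:R)%:E *
             (\sum_(i < n) \sum_(j < n)
                (Lnorm P +oo (fun w => (X i j w)%:E)) ^+ (2 * p))
               `^ ((2 * p)%:R^-1).
Proof.
(* The constant of [sum_walks_le]: [2 * 3 + 2] from its choice of [a'] and [b']. *)
exists 8%R => d T P n X Xmx indep EX0 [M XM] p p0.
have X_sym i j w : X i j w = X j i w.
  by have /matrixP/(_ i j) := Xmx w; rewrite !mxE.
have /choice[c cP] : forall ij : 'I_n * 'I_n, exists c : R,
   [/\ (0 <= c)%R, Lnorm P +oo (fun w => (X ij.1 ij.2 w)%:E) = c%:E &
       {ae P, forall w, (`|X ij.1 ij.2 w| <= c)%R}].
  by move=> ij; apply: Lnorm_infty_bound; exists M.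
pose b i j := c (i, j).
have b_ge0 i j : (0 <= b i j)%R by have [] := cP (i, j).
have bE i j : Lnorm P +oo (fun w => (X i j w)%:E) = (b i j)%:E by have [] := cP (i, j).
have Xb i j : {ae P, forall w, (`|X i j w| <= b i j)%R} by have [] := cP (i, j).
have b_sym i j : b i j = b j i.
  apply: EFin_inj; rewrite -!bE; apply: eq_Lnorm => w; by rewrite X_sym.
(* Almost surely equal to [X], hence with the same moments, but bounded everywhere. *)
pose Y := clipped X b.
have YX i j : {ae P, forall w, X i j w = Y i j w}.
  by apply: filterS (Xb i j) => w h; rewrite /Y /clipped clip_id.
have mX i j : measurable_fun setT (X i j) by exact: measurable_funPT.
have bY i j : bdd_measurable (Y i j) by exact: bdd_measurable_clipped.
have EY i j : Rintegral P setT (Y i j) = 0%R.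
  apply: EFin_inj; rewrite -[RHS]/(0 : \bar R) -[RHS](EX0 i j).
  by apply/esym/expectation_ae_eq => //; exact: YX.
pose a i j := Rintegral P setT (fun w => Y i j w ^+ 2)%R.
have aE i j : 'E_P[fun w => (X i j w ^+ 2)%R] = (a i j)%:E.
  apply: expectation_ae_eq.
  - exact: measurable_funX.
  - exact: bdd_measurableX.
  - by apply: filterS (YX i j) => w /= ->.
have a_ge0 i j : (0 <= a i j)%R by apply: Rintegral_ge0 => w _; exact: sqr_ge0.
pose m := (\sum_(w : (2 * p).-tuple 'I_n) walk_mean X b w)%R.
have L0 : (0 < 2 * p)%N by rewrite muln_gt0.
have mE : 'E_P[fun w => (schatten_norm (2 * p) (random_matrix X w) ^+ (2 * p))%R] = m%:E.
  have -> : (fun w => (schatten_norm (2 * p) (random_matrix X w) ^+ (2 * p))%R) =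
    (fun w => \sum_(u : (2 * p).-tuple 'I_n) \prod_t X (tnth u t) (tnth u (ordS t)) w)%R.
    apply/funext => w; rewrite schatten_norm_exp// mxtrace_exp//.
    by apply: eq_bigr => u _; apply: eq_bigr => t _; rewrite mxE.
  rewrite /m /walk_mean -Ex_sum; last first.
    by move=> u; apply: bdd_measurable_prod => t _; exact: bY.
  apply: expectation_ae_eq.
  - by apply: measurable_sum => u; apply: measurable_prod => t _; exact: mX.
  - by apply: bdd_measurable_sum => u _; apply: bdd_measurable_prod => t _; exact: bY.
  have : {ae P, forall w, forall i j, X i j w = Y i j w}.
    apply: filter_forall => i; apply: filter_forall => j; exact: YX.
  apply: filterS => w XY; apply: eq_bigr => u _; apply: eq_bigr => t _; exact: XY.
have m0 : (0 <= m)%R.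
  rewrite -lee_fin -mE; apply: expectation_ge0 => w; apply: exprn_ge0; exact: powR_ge0.
have -> : (\sum_(i < n) (\sum_(j < n) 'E_P[fun w => (X i j w ^+ 2)%R]) ^+ p) =
  (\sum_(i < n) (\sum_(j < n) a i j) ^+ p)%R%:E.
  rewrite -sumEFin; apply: eq_bigr => i _; rewrite EFin_expe -sumEFin.
  by congr (_ ^+ _); apply: eq_bigr => j _; rewrite aE.
have -> : (\sum_(i < n) \sum_(j < n) (Lnorm P +oo (fun w => (X i j w)%:E)) ^+ (2 * p)) =
  (\sum_(i < n) \sum_(j < n) b i j ^+ (2 * p))%R%:E.
  rewrite -sumEFin; apply: eq_bigr => i _; rewrite -sumEFin.
  by apply: eq_bigr => j _; rewrite bE EFin_expe.
rewrite mE !poweR_EFin -!EFinM -EFinD lee_fin.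
apply: le_add_powR => //.
- by apply: sumr_ge0 => i _; apply: exprn_ge0; exact: sumr_ge0.
- by apply: sumr_ge0 => i _; apply: sumr_ge0 => j _; exact: exprn_ge0.
move=> A B A0 B0 sumA sumB.
exact: (sum_walk_mean_le X_sym indep b_ge0 b_sym EY A0 B0 p0 sumA sumB).
Qed.
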